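(* Let $\mathbb{K}$ be a countably infinite field, let $U$ be a countable vector space over $\mathbb{K}$, and let $\rho_U:\mathbb{K}^*\to\operatorname{GL}(U)$ be a diagonalizable representation with only non-zero integer weights. Let $Y$ be a set and suppose $\psi:U\to Y$ is a $\rho_U$-invariant function. Then, for every $E\subset U$ with positive upper Banach density, the following holds: for every finite set $F\subset U$, there exists $u_F\in E$ such that $$\psi(F)\subseteq\psi(E-u_F).$$ In particular, $\psi(E-E)=\psi(U)$.
   Context: $(U,\rho_U)$ is diagonalizable if there are linear subspaces $U_1,\ldots,U_r\leq U$ and distinct integers $m_1,\ldots,m_r$ (the weights) such that $U=U_1\oplus\cdots\oplus U_r$ and $\rho_U(a)u_i=a^{m_i}u_i$ for all $a\in\mathbb{K}^*$, $u_i\in U_i$. A function $\psi$ on $U$ is $\rho_U$-invariant if $\psi(\rho_U(a)u)=\psi(u)$ for all $a\in\mathbb{K}^*$, $u\in U$. For a countable abelian group $A$ (here $(U,+)$), a Følner sequence is a sequence $(F_n)$ of non-empty finite subsets with $|F_n\cap(F_n+b)|/|F_n|\to1$ for every $b\in A$, and the upper Banach density of $E\subset A$ is $d^*(E)=\sup_{(F_n)}\limsup_{n\to\infty}|E\cap F_n|/|F_n|$, the supremum being over all Følner sequences in $A$. Also $E-u=\{e-u:e\in E\}$ and $E-E=\{e-e':e,e'\in E\}$. *)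

(* Defs.v *)
From HB Require Import structures.
From mathcomp Require Import all_boot all_order all_algebra.
From mathcomp Require Import finmap.
From mathcomp Require Import all_classical all_reals all_analysis.
Import numFieldNormedType.Exports.
Import Order.TTheory GRing.Theory Num.Theory.

Set Implicit Arguments.
Unset Strict Implicit.
Unset Printing Implicit Defensive.

Local Open Scope classical_set_scope.
Local Open Scope ring_scope.

(* The group K^* is the set of non-zero scalars; [rho 0] is an unconstrained
   junk value and is never used. *)
Definition representation (K : fieldType) (U : lmodType K)
    (rho : K -> {linear U -> U}) : Prop :=
  [/\ forall a, a != 0 -> bijective (rho a),
      forall u, rho 1 u = u
    & forall a b, a != 0 -> b != 0 ->
        forall u, rho (a * b) u = rho a (rho b u)].

Definition internal_direct_sum (K : fieldType) (U : lmodType K) (r : nat)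
    (W : 'I_r -> {pred U}) : Prop :=
  forall u, exists! v : {ffun 'I_r -> U},
    (forall i, v i \in W i) /\ u = \sum_(i < r) v i.

(* [a ^ m i] is the integer power [exprz]. *)
Definition weight_decomposition (K : fieldType) (U : lmodType K)
    (rho : K -> {linear U -> U})
    (r : nat) (W : 'I_r -> {pred U}) (m : 'I_r -> int) : Prop :=
  [/\ forall i, submod_closed (W i),
      internal_direct_sum W,
      injective m
    & forall a, a != 0 -> forall i u, u \in W i -> rho a u = a ^ m i *: u].

Definition diagonalizable_nonzero_weights (K : fieldType) (U : lmodType K)
    (rho : K -> {linear U -> U}) : Prop :=
  exists (r : nat) (W : 'I_r -> {pred U}) (m : 'I_r -> int),
    weight_decomposition rho W m /\ forall i, m i != 0.

Definition rep_invariant (K : fieldType) (U : lmodType K)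
    (rho : K -> {linear U -> U}) (Y : Type) (psi : U -> Y) : Prop :=
  forall a, a != 0 -> forall u, psi (rho a u) = psi u.

Definition Folner (R : realType) (A : zmodType) (F : nat -> {fset A}) : Prop :=
  (forall n, F n != fset0) /\
  forall b : A,
    ((#|` (F n `&` [fset (x + b)%R | x in F n])%fset|%:R / #|` F n|%:R : R)
      @[n --> \oo] --> (1 : R)).

Definition upper_Banach_density (R : realType) (A : zmodType) (E : set A)
    : \bar R :=
  ereal_sup [set limn_esup
      (fun n => (#|` [fset x in F n | x \in E]%fset|%:R / #|` F n|%:R : R)%:E)
    | F in @Folner R A].

Definition translate_sub (A : zmodType) (E : set A) (u : A) : set A :=
  [set e - u | e in E].

Definition difference_set (A : zmodType) (E : set A) : set A :=
  [set e - e' | e in E & e' in E].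

(* Main.v *)
Require Import Defs.
From HB Require Import structures.
From mathcomp Require Import all_boot all_order all_algebra.
From mathcomp Require Import finmap.
From mathcomp Require Import all_classical all_reals all_analysis.
From mathcomp Require Import ring lra zify.
Import numFieldNormedType.Exports.
Import Order.TTheory GRing.Theory Num.Theory.

Set Implicit Arguments.
Unset Strict Implicit.
Unset Printing Implicit Defensive.

Local Open Scope classical_set_scope.
Local Open Scope ring_scope.

(** The proof is soft harmonic analysis with invariant means in place of spectral
    measures.

    A Foelner sequence along which [E] has positive upper density gives, through
    limits along an ultrafilter, a translation-invariant mean [L] on bounded
    functions on [U] with [L (indicator R E) > 0] (lemma [Folner_mean]).  It is
    enough to show that every [S] with [L (indicator R S) > 0] contains, for each
    [f], two points [s] and [s + rho a f] with [a != 0] ([orbit_recurrence]).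
    Indeed, for each [f] in the finite set, the points [u] of [E] for which no
    [u + rho a f] lies in [E] then form a set of mean zero, so some [u] in [E]
    avoids all of these sets, and [psi f = psi (rho a f)] lies in [psi (E - u)]
    ([simultaneous_recurrence]).

    For the recurrence, let [d = L (indicator R S)].  The correlation function
    [u |-> L (1_S * 1_S (. + u)) - d ^ 2] is positive definite on [U]; if the orbit
    of [f] missed [S - S] it would equal [- d ^ 2] on that orbit, and so would its
    average over [K^*].  This contradicts [invariant_posdef_ge0]: a positive
    definite function [Z] that is invariant under the action of [K^*] is
    nonnegative.  That statement is proved on [int -> K], where the coordinate [m]
    carries the weight [m], and for vectors supported on weights that are non-zero
    in [K]; [orbit_lift] transports it to [U].  In characteristic [p], a weight
    [q * m'] with [q] a power of [p] and [p] prime to [m'] is replaced by [m'],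
    because [x |-> x ^ q] is additive.  Passing to [m'] merges weights such as [1]
    and [p], whose characters really can cancel each other.

    Nonnegativity is proved by induction on the size of the support of [w].
    Replacing all weights by their opposites if necessary, let [l] be the largest
    weight of [w], with [l > 0], and let [Zl] be the average of [Z] over translations
    along the coordinate [l].  Both [Zl] and [Z - Zl] are positive definite and
    invariant ([coordinate_mean_posdef], [coordinate_mean_complement_posdef]).
    [Zl] does not see the coordinate [l], so [0 <= Zl w] by induction.  The other part
    averages to zero along the axis [l], and this forces [(Z - Zl) w = 0].

    The vanishing rests on [van_der_corput]: if the average of [Z (v i a)] over [a]
    does not depend on [i], and that of [Z (v i a - v j a)] is zero for [i < j],
    then the former is zero.  The vector [w] may be replaced by
    [v a = weight_act (1 + a) w], as [Z] is invariant.  If all weights are positive,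
    each coordinate of [v a] is a polynomial in [a].  Substituting
    [a := g ^ (- m0) * a] and acting by [g ^ n0] multiplies the monomial of
    degree [n] in the coordinate [m] by [g ^ (n0 * m - m0 * n)]; the difference of two such
    vectors loses the monomial [(m0, n0)] and keeps every monomial whose ratio
    [n / m] is different.  The monomial [(l, 1)] is the only one of ratio [1 / l],
    since [l] is the largest weight, and its coefficient [l * w l] is not zero in
    [K]; so all the others can be removed one after another ([kill_monomials]),
    down to an average along the axis [l], which is zero.  Negative weights are
    removed beforehand by additive differences of [a |-> weight_act a^-1 w]: they
    annihilate the polynomials [a ^ (- m)], [m < 0], but not the rational function
    [a ^ (- l)], which acquires poles at distinct points
    ([kill_negative_weights]). *)

(** * Means on bounded functions *)

Definition bnd (R : realType) (X : Type) (F : X -> R) : Prop :=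
  exists C, forall x, `|F x| <= C.

(** A mean is a total function on [X -> R], constrained on bounded functions only:
    means obtained as ultrafilter limits carry no information elsewhere. *)
Definition is_mean (R : realType) (X : Type) (L : (X -> R) -> R) : Prop :=
  [/\ forall F G, bnd F -> bnd G -> L (fun x => F x + G x) = L F + L G,
      forall c F, bnd F -> L (fun x => c * F x) = c * L F,
      forall F, bnd F -> (forall x, 0 <= F x) -> 0 <= L F
    & L (fun=> 1) = 1].

Section Bounded.
Context (R : realType) (X : Type).
Implicit Types F G : X -> R.

Lemma bnd_cst (c : R) : bnd (fun _ : X => c).
Proof. by exists `|c|. Qed.

Lemma bndD F G : bnd F -> bnd G -> bnd (fun x => F x + G x).
Proof.
move=> [C hC] [D hD]; exists (C + D) => x.
by apply: le_trans (ler_normD _ _) (lerD _ _).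
Qed.

Lemma bndM F G : bnd F -> bnd G -> bnd (fun x => F x * G x).
Proof.
move=> [C hC] [D hD]; exists (C * D) => x.
by rewrite normrM ler_pM.
Qed.

Lemma bndN F : bnd F -> bnd (fun x => - F x).
Proof. by move=> [C hC]; exists C => x; rewrite normrN. Qed.

Lemma bndB F G : bnd F -> bnd G -> bnd (fun x => F x - G x).
Proof. by move=> hF hG; apply: bndD => //; apply: bndN. Qed.

Lemma bnd_comp (Y : Type) (g : Y -> X) F : bnd F -> bnd (fun y => F (g y)).
Proof. by move=> [C hC]; exists C => y; apply: hC. Qed.

Lemma bnd_sum (I : Type) (s : seq I) (P : I -> X -> R) :
  (forall i, bnd (P i)) -> bnd (fun x => \sum_(i <- s) P i x).
Proof.
move=> hP; elim: s => [|i s IH].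
  by exists 0 => x; rewrite big_nil normr0.
have [C hC] := bndD (hP i) IH; exists C => x.
by rewrite big_cons; apply: hC.
Qed.

End Bounded.

Section MeanTheory.
Context (R : realType) (X : Type) (L : (X -> R) -> R) (meanL : is_mean L).
Implicit Types F G : X -> R.

Lemma meanD F G : bnd F -> bnd G -> L (fun x => F x + G x) = L F + L G.
Proof. by case: meanL => h _ _ _; apply: h. Qed.

Lemma meanZ c F : bnd F -> L (fun x => c * F x) = c * L F.
Proof. by case: meanL => _ h _ _; apply: h. Qed.

Lemma mean_ge0 F : bnd F -> (forall x, 0 <= F x) -> 0 <= L F.
Proof. by case: meanL => _ _ h _; apply: h. Qed.

Lemma mean_cst c : L (fun=> c) = c.
Proof.
case: meanL => _ h _ h1.
have -> : (fun=> c) = (fun x : X => c * 1) by apply: funext => x; rewrite mulr1.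
by rewrite h ?h1 ?mulr1//; apply: bnd_cst.
Qed.

Lemma meanN F : bnd F -> L (fun x => - F x) = - L F.
Proof.
move=> hF; rewrite -mulN1r -meanZ//; congr L.
by apply: funext => x; rewrite mulN1r.
Qed.

Lemma meanB F G : bnd F -> bnd G -> L (fun x => F x - G x) = L F - L G.
Proof. by move=> hF hG; rewrite meanD ?meanN//; apply: bndN. Qed.

Lemma mean_le F G : bnd F -> bnd G -> (forall x, F x <= G x) -> L F <= L G.
Proof.
move=> hF hG le; rewrite -subr_ge0 -meanB//.
by apply: mean_ge0 => [|x]; [apply: bndB|rewrite subr_ge0].
Qed.

Lemma mean_norm_le F C : (forall x, `|F x| <= C) -> `|L F| <= C.
Proof.
move=> hF; have bF : bnd F by exists C.
rewrite ler_norml -{1}[C]mean_cst -{2}[C]mean_cst -meanN; last exact: bnd_cst.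
by apply/andP; split; apply: mean_le => //; (try exact: bnd_cst) => x;
   have := hF x; rewrite ler_norml => /andP[].
Qed.

Lemma mean_sum (I : Type) (s : seq I) (P : I -> X -> R) :
  (forall i, bnd (P i)) ->
  L (fun x => \sum_(i <- s) P i x) = \sum_(i <- s) L (P i).
Proof.
move=> hP; elim: s => [|i s IH].
  rewrite big_nil -[RHS]mean_cst; congr L.
  by apply: funext => x; rewrite big_nil.
rewrite big_cons -IH -meanD//; last exact: bnd_sum.
by congr L; apply: funext => x; rewrite big_cons.
Qed.

End MeanTheory.

(** * Limits along a free ultrafilter *)

Lemma free_ultrafilter_exists :
  exists G : set_system nat, UltraFilter G /\ \oo `<=` G.
Proof. exact: ultraFilterLemma. Qed.

Definition free_ultrafilter : set_system nat :=
  projT1 (cid free_ultrafilter_exists).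

Lemma free_ultrafilterP : UltraFilter free_ultrafilter /\ \oo `<=` free_ultrafilter.
Proof. exact: projT2 (cid free_ultrafilter_exists). Qed.

#[global] Instance free_ultrafilter_ultra : UltraFilter free_ultrafilter.
Proof. exact: free_ultrafilterP.1. Qed.

Definition ulim (R : realType) (f : nat -> R) : R := lim (f @ free_ultrafilter).

Section UltraLimit.
Context (R : realType).
Implicit Types f g : nat -> R.

(** An ultrafilter containing a compact set converges. *)
Lemma ulim_cvg f : bnd f -> f @ free_ultrafilter --> ulim f.
Proof.
move=> [C hC].
have := @segment_compact R (- C) C;
  rewrite compact_ultra => /(_ (f @ free_ultrafilter)).
have UF : UltraFilter (f @ free_ultrafilter).
  split; first exact: fmap_proper_filter.
  move=> G PG sub; apply/seteqP; split => // A GA.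
  case: (in_ultra_setVsetC (f @^-1` A) free_ultrafilter_ultra) => // hA.
  have : G (~` A) by apply: sub.
  move=> GnA; have := filterI GA GnA; rewrite setICr => G0.
  by exfalso; apply: (@filter_not_empty _ G); apply: G0; exact: PG.
have h : (f @ free_ultrafilter) `[(- C), C]%classic.
  by apply: nearW => n; rewrite /= in_itv /= -ler_norml.
move=> /(_ UF h) [p [_ hp]].
by rewrite /ulim (cvg_lim _ hp).
Qed.

Lemma ulim_eq f (l : R) : f @ free_ultrafilter --> l -> ulim f = l.
Proof. by move=> h; rewrite /ulim; apply: cvg_lim. Qed.

Lemma ulim_cvg_oo f (l : R) : f @ \oo --> l -> ulim f = l.
Proof.
move=> h; apply: ulim_eq; apply: cvg_trans h.
by move=> A; apply: free_ultrafilterP.2.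
Qed.

Lemma ulim_mean : is_mean (@ulim R).
Proof.
split=> [F G hF hG|c F hF|F hF F0|].
- by apply: ulim_eq; apply: cvgD; apply: ulim_cvg.
- by apply: ulim_eq; apply: cvgMr; apply: ulim_cvg.
- apply: (@limr_ge _ _ _ _ _ F); last exact: nearW.
  by apply/cvg_ex; exists (ulim F); apply: ulim_cvg.
- by apply: ulim_eq; apply: cvg_cst.
Qed.

End UltraLimit.

Lemma ulim_near_eq (R : realType) (f g : nat -> R) : bnd g ->
  (\forall n \near \oo, f n = g n) -> ulim f = ulim g.
Proof.
move=> bg fg; apply: ulim_eq; apply: cvg_trans (ulim_cvg bg).
apply: near_eq_cvg.
have h : \forall n \near free_ultrafilter, f n = g n.
  exact: free_ultrafilterP.2 fg.
by apply: filterS h => n /= ->.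
Qed.

(** * Invariant means *)

Definition invariant_under (R : realType) (X : Type) (L : (X -> R) -> R)
  (g : X -> X) : Prop := forall F, bnd F -> L (fun x => F (g x)) = L F.

(** Averaging over longer and longer pieces of the orbits of [T] turns a mean into
    a [T]-invariant one. *)
Definition orbit_mean (R : realType) (X : Type) (T : X -> X)
    (L : (X -> R) -> R) (F : X -> R) : R :=
  ulim (fun N => L (fun x => N.+1%:R^-1 * \sum_(n < N.+1) F (iter n T x))).

Section OrbitMean.
Context (R : realType) (X : Type) (T : X -> X) (L : (X -> R) -> R).
Hypothesis meanL : is_mean L.

Let avg N F : X -> R := fun x => N.+1%:R^-1 * \sum_(n < N.+1) F (iter n T x).

Let avg_le F C N : (forall x, `|F x| <= C) -> forall x, `|avg N F x| <= C.
Proof.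
move=> hC x; rewrite /avg normrM ger0_norm ?invr_ge0//.
rewrite mulrC ler_pdivrMr ?ltr0n//.
apply: le_trans (ler_norm_sum _ _ _) _.
apply: (@le_trans _ _ (\sum_(n < N.+1) C)).
  by apply: ler_sum => i _; apply: hC.
by rewrite sumr_const card_ord mulr_natr.
Qed.

Let avg_bnd F N : bnd F -> bnd (avg N F).
Proof. by move=> [C hC]; exists C; apply: avg_le. Qed.

Let seq_bnd F : bnd F -> bnd (fun N => L (avg N F)).
Proof. by move=> [C hC]; exists C => N; apply: mean_norm_le => //; apply: avg_le. Qed.

Lemma orbit_mean_mean : is_mean (orbit_mean T L).
Proof.
split=> [F G hF hG|c F hF|F hF F0|].
- rewrite /orbit_mean -(meanD (ulim_mean R)); [|exact: seq_bnd..].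
  congr (ulim _); apply: funext => N.
  rewrite -meanD//; [|exact: avg_bnd..].
  by congr L; apply: funext => x; rewrite big_split/= mulrDr.
- rewrite /orbit_mean -(meanZ (ulim_mean R)); [|exact: seq_bnd].
  congr (ulim _); apply: funext => N.
  rewrite -meanZ//; [|exact: avg_bnd].
  by congr L; apply: funext => x; rewrite mulrCA -mulr_sumr.
- apply: (mean_ge0 (ulim_mean R)); first exact: seq_bnd.
  move=> N; apply: mean_ge0 => //; first exact: avg_bnd.
  by move=> x; rewrite mulr_ge0 ?invr_ge0// sumr_ge0.
- rewrite -[RHS](mean_cst (ulim_mean R)); congr (ulim _); apply: funext => N.
  rewrite -[RHS](mean_cst meanL); congr L; apply: funext => x.
  by rewrite sumr_const card_ord -[_ *+ _]mulr_natl mulr1 mulVf// pnatr_eq0.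
Qed.

Lemma orbit_mean_invariant : invariant_under (orbit_mean T L) T.
Proof.
move=> F bF; have [C hC] := bF.
apply/eqP; rewrite -subr_eq0 -meanB; [|exact: orbit_mean_mean|exact: bnd_comp|by []].
apply/eqP; apply: ulim_cvg_oo; apply/cvgr0Pnorm_le => e e0.
near=> N.
apply: (@le_trans _ _ (N.+1%:R^-1 * (C + C))).
  apply: mean_norm_le => // x.
  rewrite normrM ger0_norm ?invr_ge0// ler_pM2l ?invr_gt0 ?ltr0n//.
  rewrite -(big_mkord xpredT (fun n => F (iter n.+1 T x) - F (iter n T x))).
  rewrite telescope_sumr//.
  by apply: le_trans (ler_normB _ _) _; apply: lerD.
rewrite mulrC ler_pdivrMr ?ltr0n// mulrC -ler_pdivrMr//.
apply: (@le_trans _ _ N%:R); last by rewrite ler_nat.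
near: N; exact: nbhs_infty_ger.
Unshelve. all: by end_near. Qed.

(** Invariance under [G] survives the averaging when [T] normalizes [G], since
    [S \o T^n = T^n \o S'] for some [S'] in [G]. *)
Lemma orbit_mean_preserves (G : set (X -> X)) :
  (forall S, G S -> invariant_under L S) ->
  (forall S, G S -> exists2 S', G S' & forall x, S (T x) = T (S' x)) ->
  forall S, G S -> invariant_under (orbit_mean T L) S.
Proof.
move=> invG normG S GS F bF; congr (ulim _); apply: funext => N.
have h n : exists2 S', G S' & forall x, S (iter n T x) = iter n T (S' x).
  elim: n S GS => [|n IH] S GS; first by exists S.
  have [S' GS' hS'] := normG _ GS.
  have [S2 GS2 hS2] := IH _ GS'.
  by exists S2 => // x; rewrite !iterS hS' hS2.
have bF' (g : X -> X) : bnd (fun x => F (g x)) by apply: bnd_comp.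
rewrite (meanZ meanL); last first.
  by apply: (@bnd_sum R X _ _ (fun i : 'I_N.+1 => fun x => F (S (iter i T x)))) => i;
    apply: bF'.
rewrite (meanZ meanL); last first.
  by apply: (@bnd_sum R X _ _ (fun i : 'I_N.+1 => fun x => F (iter i T x))) => i;
    apply: bF'.
congr (_ * _).
rewrite (@mean_sum _ _ _ meanL _ _ (fun i : 'I_N.+1 => fun x => F (S (iter i T x))));
  last first.
  by move=> i; apply: bF'.
rewrite (@mean_sum _ _ _ meanL _ _ (fun i : 'I_N.+1 => fun x => F (iter i T x)));
  last first.
  by move=> i; apply: bF'.
apply: eq_bigr => i _; have [S' GS' hS'] := h i.
rewrite -(invG _ GS' (fun x => F (iter i T x))); last exact: bF'.
by congr L; apply: funext => x; rewrite hS'.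
Qed.

End OrbitMean.

(** The maps [T i] are averaged out one at a time, and the resulting sequence of means
    is then averaged along the ultrafilter: each [T i] leaves invariant all but
    finitely many terms. *)
Lemma invariant_mean_extend (R : realType) (X : Type) (L : (X -> R) -> R)
    (G : set (X -> X)) (T : nat -> X -> X) : is_mean L ->
  (forall S, G S -> invariant_under L S) ->
  (forall i j x, T i (T j x) = T j (T i x)) ->
  (forall S i, G S -> exists2 S', G S' & forall x, S (T i x) = T i (S' x)) ->
  exists L' : (X -> R) -> R, [/\ is_mean L',
    forall S, G S -> invariant_under L' S & forall i, invariant_under L' (T i)].
Proof.
move=> mL invG commT normG.
pose Ls := fix Ls i := if i is i'.+1 then orbit_mean (T i') (Ls i') else L.
pose Gs i := [set S | G S \/ exists2 j, (j < i)%N & S = T j].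
have mLs i : is_mean (Ls i) by elim: i => //= i; apply: orbit_mean_mean.
have invLs i S : Gs i S -> invariant_under (Ls i) S.
  elim: i S => [|i IH] S; first by move=> [/invG//|[]].
  have [hS|nS] := pselect (Gs i S).
    move=> _ /=; apply: (@orbit_mean_preserves _ _ _ _ (mLs i) (Gs i)) => // S1.
    move=> [|[j ji ->]].
      by move/(normG _ i) => [S' GS' hS']; exists S' => //; left.
    by exists (T j) => //; right; exists j.
  move=> [GS|[j]]; first by case: nS; left.
  rewrite ltnS leq_eqVlt => /predU1P[-> ->|ji ST].
    exact: orbit_mean_invariant.
  by case: nS; right; exists j.
have bLs F : bnd F -> bnd (fun i => Ls i F).
  by move=> [C hC]; exists C => i; apply: mean_norm_le.
exists (fun F => ulim (fun i => Ls i F)); split.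
- split=> [F F' bF bF'|c F bF|F bF F0|].
  + rewrite -(meanD (ulim_mean R)); [|exact: bLs..]; congr ulim.
    by apply: funext => i; rewrite meanD.
  + rewrite -(meanZ (ulim_mean R)); [|exact: bLs..]; congr ulim.
    by apply: funext => i; rewrite meanZ.
  + apply: (mean_ge0 (ulim_mean R)); first exact: bLs.
    by move=> i; apply: mean_ge0.
  + rewrite -[RHS](mean_cst (ulim_mean R)); congr ulim.
    by apply: funext => i; rewrite mean_cst.
- move=> S GS F bF; congr ulim; apply: funext => i.
  by rewrite invLs//; left.
- move=> j F bF; apply: ulim_near_eq; first exact: bLs.
  exists j.+1 => // i /= ji; rewrite invLs//; right; by exists j.
Qed.

Lemma countable_surj (X : choiceType) (x0 : X) :
  countable [set: X] -> exists e : nat -> X, forall x, exists n, e n = x.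
Proof.
move=> /countable_injP[f finj].
exists (fun n => xget x0 [set x | f x = n]) => x; exists (f x).
case: xgetP => [y _ /= yx|/(_ x) []//].
by apply: finj; rewrite ?in_setT.
Qed.

Definition affine_mean (R : realType) (K : fieldType) (L : (K -> R) -> R) : Prop :=
  [/\ is_mean L,
      forall b, invariant_under L (fun x => x + b)
    & forall a, a != 0 -> invariant_under L (fun x => a * x)].

(** The affine group of [K] is solvable, hence amenable: translations are averaged out
    first, and then dilations, which normalize the translations. *)
Lemma affine_mean_exists (R : realType) (K : fieldType) :
  countable [set: K] -> exists L : (K -> R) -> R, affine_mean L.
Proof.
move=> cK; have [e he] := countable_surj 0 cK.
have m0 : is_mean (fun F : K -> R => F 0) by split.
have [|||L1 [mL1 _ iL1]] := @invariant_mean_extend R K _ set0 (fun n x => x + e n) m0.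
- by move=> S [].
- by move=> i j x; rewrite addrAC.
- by move=> S i [].
have tL1 b : invariant_under L1 (fun x => x + b) by have [n <-] := he b; apply: iL1.
pose s n := if e n == 0 then 1 else e n.
have s0 n : s n != 0 by rewrite /s; case: ifPn => // _; apply: oner_neq0.
have [|||L2 [mL2 tL2 iL2]] := @invariant_mean_extend R K _
    [set S | exists b, S = fun x => x + b] (fun n x => s n * x) mL1.
- by move=> _ [b ->].
- by move=> i j x; rewrite mulrCA.
- move=> _ i [b ->]; exists (fun x => x + (s i)^-1 * b);
  first by exists ((s i)^-1 * b).
  by move=> x; rewrite mulrDr mulVKf.
exists L2; split => // [b|a a0]; first by apply: tL2; exists b.
have [n en] := he a.
by have := iL2 n; rewrite /s en (negbTE a0).
Qed.

Lemma nonroot_exists (K : fieldType) (p : {poly K}) :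
  infinite_set [set: K] -> p != 0 -> exists x, p.[x] != 0.
Proof.
move=> infK p0; have [B _ cB] := infinite_set_fset (size p) infK.
have : ~~ all (root p) B.
  apply/negP => rB.
  by have := max_poly_roots p0 rB (fset_uniq B); rewrite ltnNge cB.
by move=> /allPn[x _ rx]; exists x.
Qed.

Lemma archimedean_eq0 (R : realType) (c C : R) :
  (forall n, n%:R * `|c| <= C) -> c = 0.
Proof.
move=> h; apply/eqP/negPn/negP => c0.
have c1 : 0 < `|c| by rewrite normr_gt0.
have C0 : 0 <= C by have := h 0%N; rewrite mul0r.
have := h (Num.bound (C / `|c|)); rewrite leNgt => /negP; apply.
by rewrite -ltr_pdivrMr// archi_boundP// divr_ge0.
Qed.

Section FiniteSetsAreNull.
Context (R : realType) (K : fieldType) (L : (K -> R) -> R).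
Hypotheses (infK : infinite_set [set: K]) (affL : affine_mean L).

Let meanL : is_mean L. Proof. by case: affL. Qed.
Let pt (c : K) : K -> R := fun x => (x == c)%:R.
Let bpt c : bnd (pt c).
Proof. by exists 1 => x; rewrite /pt; case: (_ == _); rewrite ?normr1 ?normr0. Qed.

(** Points are translates of each other, so [n] of them have [n] times the mean of one,
    which is at most [1] for all [n]. *)
Lemma affine_mean_point c : L (fun x => (x == c)%:R) = 0.
Proof.
have e d : L (pt d) = L (pt c).
  case: affL => _ /(_ (c - d)) h _.
  rewrite -(h (pt c) (bpt c)); congr L; apply: funext => x.
  rewrite /pt; have -> // : (x == d) = (x + (c - d) == c).
  by rewrite addrCA -[X in _ = (_ == X)]addr0 (inj_eq (addrI c)) subr_eq0.
apply: (@archimedean_eq0 _ _ 1) => n.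
have [B _ cB] := infinite_set_fset n infK.
have p0 : 0 <= L (pt c) by apply: mean_ge0.
rewrite ger0_norm//.
have -> : L (fun x => (x == c)%:R) = L (pt c) by [].
apply: (@le_trans _ _ (L (fun x => \sum_(d <- B) pt d x))).
  rewrite mean_sum//; under eq_bigr => d _ do rewrite e.
  rewrite big_const_seq count_predT iter_addr_0 -[X in _ <= X]mulr_natl.
  by rewrite ler_wpM2r// ler_nat.
rewrite -[leRHS](mean_cst meanL); apply: mean_le => //.
- exact: bnd_sum.
- exact: bnd_cst.
move=> x; rewrite /pt; have [xB|xB] := boolP (x \in B).
  rewrite (big_rem x)//= eqxx big_seq big1 ?addr0// => d.
  by rewrite mem_rem_uniq ?fset_uniq// inE => /andP[dx _]; rewrite eq_sym (negbTE dx).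
rewrite big_seq big1// => d dB; case: eqP => // xd; by rewrite xd dB in xB.
Qed.

Lemma affine_mean_finite (s : seq K) (F : K -> R) :
  bnd F -> (forall x, x \notin s -> F x = 0) -> L F = 0.
Proof.
move=> bF Fs; have [C hC] := bF.
pose G x := C * \sum_(d <- s) pt d x.
have bS : bnd (fun x => \sum_(d <- s) pt d x) by apply: bnd_sum.
have bG : bnd G by apply: bndM => //; apply: bnd_cst.
have G0 : L G = 0.
  by rewrite meanZ// mean_sum// big1 ?mulr0// => d _; apply: affine_mean_point.
have FG x : `|F x| <= G x.
  have C0 : 0 <= C by apply: le_trans (hC x).
  have [xs|/Fs->] := boolP (x \in s); last first.
    by rewrite normr0 mulr_ge0// sumr_ge0.
  apply: le_trans (hC x) _; rewrite /G ler_peMr// (big_rem x)//= /pt eqxx.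
  by rewrite lerDl sumr_ge0.
apply/eqP; rewrite eq_le; apply/andP; split.
  rewrite -G0; apply: mean_le => // x; exact: le_trans (ler_norm _) (FG x).
rewrite -oppr_le0 -meanN// -G0; apply: mean_le => //; first exact: bndN.
by move=> x; apply: le_trans (FG x); rewrite -normrN ler_norm.
Qed.

Lemma affine_mean_eq_off (s : seq K) (F G : K -> R) :
  bnd F -> bnd G -> (forall x, x \notin s -> F x = G x) -> L F = L G.
Proof.
move=> bF bG FG; apply/eqP; rewrite -subr_eq0 -meanB//; apply/eqP.
apply: (@affine_mean_finite s); first exact: bndB.
by move=> x /FG ->; rewrite subrr.
Qed.

End FiniteSetsAreNull.

(** * Positive definite functions *)

Definition quadratic_form (R : realType) (V : zmodType) (s : seq (R * V))
    (Z : V -> R) : R :=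
  \sum_(x <- s) \sum_(y <- s) x.1 * y.1 * Z (x.2 - y.2).

(** Evenness has to be required separately: over the reals, nonnegativity of the
    quadratic forms constrains only the even part of [Z]. *)
Definition posdef (R : realType) (V : zmodType) (Z : V -> R) : Prop :=
  (forall u, Z (- u) = Z u) /\
  forall s : seq (R * V), 0 <= quadratic_form s Z.

Section MeanQuadraticForm.
Context (R : realType) (V : zmodType) (X : Type) (L : (X -> R) -> R).
Hypothesis meanL : is_mean L.
Context (s : seq (R * V)) (f : X -> V -> R).
Hypothesis bf : forall u, bnd (fun a => f a u).

Let g (x y : R * V) a : R := x.1 * y.1 * f a (x.2 - y.2).
Let bg x y : bnd (g x y). Proof. by apply: bndM => //; apply: bnd_cst. Qed.
Let bgs x : bnd (fun a => \sum_(y <- s) g x y a). Proof. exact: bnd_sum. Qed.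

Lemma quadratic_form_bnd : bnd (fun a => quadratic_form s (f a)).
Proof. exact: (bnd_sum s bgs). Qed.

Lemma mean_quadratic_form :
  L (fun a => quadratic_form s (f a)) =
  quadratic_form s (fun u => L (fun a => f a u)).
Proof.
rewrite (mean_sum meanL s bgs); apply: eq_bigr => x _.
rewrite (mean_sum meanL s (bg x)); apply: eq_bigr => y _.
exact: meanZ.
Qed.

End MeanQuadraticForm.

Lemma posdef_mean (R : realType) (V : zmodType) (X : Type)
    (L : (X -> R) -> R) (f : X -> V -> R) : is_mean L ->
  (forall u, bnd (fun a => f a u)) -> (forall a, posdef (f a)) ->
  posdef (fun u => L (fun a => f a u)).
Proof.
move=> meanL bf pf; split=> [u|s].
  by congr L; apply: funext => a; apply: (pf a).1.
rewrite -mean_quadratic_form//; apply: mean_ge0 => // [|a].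
  exact: quadratic_form_bnd.
exact: (pf a).2.
Qed.

Section PositiveDefinite.
Context (R : realType) (V : zmodType) (Z : V -> R) (pZ : posdef Z).

Lemma posdef_norm_le u : `|Z u| <= Z 0.
Proof.
have [ev h] := pZ.
have := h [:: (1, 0); (1, u)]; have := h [:: (1, 0); (-1, u)].
rewrite /quadratic_form !big_cons !big_nil/= !subrr subr0 sub0r ev => h1 h2.
rewrite ler_norml; apply/andP; split; lra.
Qed.

Lemma posdef_bnd (X : Type) (v : X -> V) : bnd (fun a => Z (v a)).
Proof. by exists (Z 0) => a; apply: posdef_norm_le. Qed.

Lemma posdef_ge0 : 0 <= Z 0.
Proof. exact: le_trans (posdef_norm_le 0). Qed.

(** Positive definiteness at the points [0] and [v i a], [i < N], with weights [t] and
    [1], averages to [t ^ 2 * Z 0 + 2 * t * N * c + N * Z 0 >= 0], because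
    the off-diagonal terms vanish.  A suitable [t] of order [sqrt N] bounds
    [`|c|] by a multiple of [1 / sqrt N]. *)
Lemma van_der_corput (X : Type) (L : (X -> R) -> R) (v : nat -> X -> V) (c : R) :
  is_mean L -> (forall i, L (fun a => Z (v i a)) = c) ->
  (forall i j, (i < j)%N -> L (fun a => Z (v i a - v j a)) = 0) -> c = 0.
Proof.
move=> mL Lc L0; have [ev psd] := pZ.
have key N (t : R) : 0 <= t ^+ 2 * Z 0 + 2 * t * N%:R * c + N%:R * Z 0.
  pose F a := t ^+ 2 * Z 0 + 2 * t * (\sum_(i <- iota 0 N) Z (v i a)) +
     \sum_(i <- iota 0 N) \sum_(j <- iota 0 N) Z (v i a - v j a).
  have b1 : bnd (fun a => \sum_(i <- iota 0 N) Z (v i a)).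
    by apply: (@bnd_sum R X _ _ (fun i a => Z (v i a))) => i; apply: posdef_bnd.
  have b3 i : bnd (fun a => \sum_(j <- iota 0 N) Z (v i a - v j a)).
    by apply: (@bnd_sum R X _ _ (fun j a => Z (v i a - v j a))) => j;
      apply: posdef_bnd.
  have b2 : bnd (fun a => \sum_(i <- iota 0 N) \sum_(j <- iota 0 N) Z (v i a - v j a)).
    exact: (@bnd_sum R X _ _ (fun i a => \sum_(j <- iota 0 N) Z (v i a - v j a))).
  have b4 : bnd (fun a => 2 * t * (\sum_(i <- iota 0 N) Z (v i a))).
    by apply: bndM => //; apply: bnd_cst.
  have b5 : bnd (fun a => t ^+ 2 * Z 0 + 2 * t * (\sum_(i <- iota 0 N) Z (v i a))).
    by apply: bndD => //; apply: bnd_cst.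
  have LF : L F = t ^+ 2 * Z 0 + 2 * t * N%:R * c + N%:R * Z 0.
    rewrite /F (meanD mL)// (meanD mL)//; last exact: bnd_cst.
    rewrite (mean_cst mL) (meanZ mL)//.
    rewrite (@mean_sum _ _ _ mL _ _ (fun i a => Z (v i a))); last by move=> i;
      apply: posdef_bnd.
    rewrite (@mean_sum _ _ _ mL _ _ (fun i a => \sum_(j <- iota 0 N) Z (v i a - v j a)))//.
    under eq_bigr => i _ do rewrite Lc.
    rewrite big_const_seq count_predT iter_addr_0 size_iota -[c *+ N]mulr_natl mulrA.
    congr (_ + _).
    rewrite (eq_big_seq (fun=> Z 0)) => [|i iN].
      by rewrite big_const_seq count_predT iter_addr_0 size_iota mulr_natl.
    rewrite (@mean_sum _ _ _ mL _ _ (fun j a => Z (v i a - v j a)));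
      last by move=> j; apply: posdef_bnd.
    rewrite (big_rem i)//= big_seq big1 ?addr0 => [|j].
      by rewrite -[RHS](mean_cst mL); congr L; apply: funext => a; rewrite subrr.
    rewrite mem_rem_uniq ?iota_uniq// inE => /andP[ji _].
    have [ij|ij|ij] := ltngtP i j; first exact: L0.
      rewrite -(L0 _ _ ij); congr L; apply: funext => a.
      by rewrite -ev opprB.
    by rewrite ij eqxx in ji.
  rewrite -LF; apply: mean_ge0 => //; first exact: bndD.
  move=> a; have := psd ((t, 0) :: [seq (1, v i a) | i <- iota 0 N]).
  rewrite /quadratic_form big_cons/= big_cons/= subrr !big_map.
  rewrite (eq_bigr (fun i => t * Z (v i a))); last first.
    by move=> i _ /=; rewrite sub0r ev mulr1.
  rewrite [X in _ + X](eq_bigr (fun i =>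
      t * Z (v i a) + \sum_(j <- iota 0 N) Z (v i a - v j a))); last first.
    move=> i _; rewrite big_cons/= big_map/= subr0 mul1r; congr (_ + _).
    by apply: eq_bigr => j _; rewrite !mul1r.
  by rewrite big_split/= -!mulr_sumr /F => h; apply: le_trans h _; lra.
(* [N] is taken to be a square, which avoids square roots in [t]. *)
apply: (@archimedean_eq0 _ _ (Z 0)) => M.
have [->|M0] := posnP M; first by rewrite mul0r posdef_ge0.
have M1 : 0 < M%:R ^+ 2 :> R by rewrite exprn_gt0// ltr0n.
have := key (M * M)%N M%:R; have := key (M * M)%N (- M%:R).
rewrite natrM => h1 h2.
rewrite -[X in _ * `|X| <= _]/c -(ger0_norm (ler0n _ M)) -normrM ler_norml.
by apply/andP; split; rewrite -(ler_pM2l M1); lra.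
Qed.

End PositiveDefinite.

(** * Vectors with positive weights *)

Lemma greedy_sequence (T : eqType) (G : T -> Prop) (Q : T -> T -> Prop) :
  (forall s : seq T, exists2 x, G x & forall y, y \in s -> Q y x) ->
  exists f : nat -> T, (forall i, G (f i)) /\ forall i j, (i < j)%N -> Q (f i) (f j).
Proof.
move=> h.
have /choice[nxt hn] : forall s : seq T, exists x, G x /\ forall y, y \in s -> Q y x.
  by move=> s; have [x Gx Qx] := h s; exists x.
pose F := fix F n := if n is n'.+1 then nxt (F n') :: F n' else [::].
exists (fun n => nxt (F n)); split => [i|i j ij]; first by case: (hn (F i)).
apply: (hn (F j)).2.
elim: j ij => // j IH; rewrite ltnS leq_eqVlt => /predU1P[->|ij].
  by rewrite /= inE eqxx.
by rewrite /= inE IH ?orbT.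
Qed.

(** Only finitely many [x] share their [e]-th power with an earlier term. *)
Lemma distinct_powers (K : fieldType) (e : int) :
  infinite_set [set: K] -> e != 0 ->
  exists g : nat -> K, (forall i, g i != 0) /\
    forall i j, (i < j)%N -> g i ^ e != g j ^ e.
Proof.
move=> infK e0.
apply: (@greedy_sequence K (fun x => x != 0) (fun y x => y ^ e != x ^ e)) => s.
pose n := `|e|%N; have n0 : (0 < n)%N by rewrite absz_gt0.
have nzP (c : K) : 'X^n - c%:P != 0 by rewrite -size_poly_gt0 size_XnsubC.
have [|x] := @nonroot_exists K ('X * \prod_(y <- s) ('X^n - (y ^+ n)%:P)) infK.
  by rewrite mulf_neq0 ?polyX_eq0// prodf_seq_neq0; apply/allP => y _ /=; apply: nzP.
rewrite hornerM hornerX mulf_eq0 negb_or => /andP[x0].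
rewrite horner_prod prodf_seq_neq0 => /allP hs; exists x => // y /hs /=.
rewrite !hornerE subr_eq0; apply: contra => /eqP yx.
by rewrite !exprnP /n abszEsg mulrC -!exprz_exp yx.
Qed.

(** On [int -> K] the index of a coordinate is also its weight.  As a function of
    [b] in [K], [weight_act] is multiplicative even at [b = 0]. *)
Definition weight_act (K : fieldType) (b : K) (c : int -> K) : int -> K :=
  fun m => b ^ m * c m.

Definition weight_invariant (R : realType) (K : fieldType)
    (Z : (int -> K) -> R) : Prop :=
  forall b c, b != 0 -> Z (weight_act b c) = Z c.

Definition single (K : fieldType) (l : int) (x : K) : int -> K :=
  fun m => if m == l then x else 0.

Section Vanishing.
Context (R : realType) (K : fieldType) (L : (K -> R) -> R).
Hypotheses (infK : infinite_set [set: K]) (affL : affine_mean L).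
Context (Z : (int -> K) -> R).
Hypotheses (pZ : posdef Z) (invZ : weight_invariant Z).
Context (l : nat).
Hypotheses (l0 : l%:R != 0 :> K)
  (Zl : L (fun a => Z (single l%:Z a)) = 0).

Let meanL : is_mean L. Proof. by case: affL. Qed.

(** [E] lists the monomials still to be removed, [(m, n)] standing for degree [n] in
    the coordinate [m].  All of them have a ratio [n / m] different from [1 / l], so
    removing one leaves a non-zero coefficient at [(l, 1)]; once [E] is
    empty, the average is one along the axis [l], which is zero by assumption. *)
Lemma kill_monomials (E : seq (int * nat)) (P : int -> {poly K}) :
  (forall p, p \in E -> p.2%:Z * l%:Z != p.1) ->
  (P l%:Z)`_1 != 0 ->
  (forall m n, (P m)`_n != 0 -> (m, n) = (l%:Z, 1%N) \/ (m, n) \in E) ->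
  L (fun a => Z (fun m => (P m).[a])) = 0.
Proof.
elim: E P => [|[m0 n0] E IH] P hE hl hP.
  have Pe a : (fun m => (P m).[a]) = single l%:Z ((P l%:Z)`_1 * a).
    apply: funext => m; rewrite horner_coef /single.
    have z n : (m, n) <> (l%:Z, 1%N) -> (P m)`_n = 0.
      by move=> mn; apply/eqP/negPn/negP => /hP[].
    case: eqP => [ml|ml]; last first.
      by rewrite big1// => i _; rewrite z ?mul0r// => -[].
    rewrite ml in z *.
    have sz : (1 < size (P l))%N.
      by rewrite ltnNge; apply: contra hl => h; rewrite nth_default.
    rewrite (bigD1 (Ordinal sz))//= expr1 big1 ?addr0// => i i1.
    rewrite z ?mul0r// => -[] i1'; case/eqP: i1; exact: val_inj.
  under eq_fun do rewrite Pe.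
  have [_ _ /(_ _ hl) h] := affL.
  by rewrite (h (fun a => Z (single l%:Z a)))//; apply: posdef_bnd.
(* [e] is the exponent with which the rescaling by [g] acts on the monomial
   [(l, 1)]; distinct values of [g i ^ e] make that coefficient survive. *)
pose e : int := n0%:Z * l%:Z - m0.
have e0 : e != 0 by rewrite subr_eq0; apply: (hE (m0, n0)); rewrite inE eqxx.
have [g [g0 gd]] := distinct_powers infK e0.
pose v i a m := g i ^ (n0%:Z * m) * (P m).[g i ^ (- m0) * a].
apply: (van_der_corput pZ (v := v) meanL) => [i|i j ij].
  have [_ _ /(_ (g i ^ (- m0)))] := affL.
  rewrite expfz_eq0 (negbTE (g0 i)) andbF => /(_ isT).
  move=> /(_ (fun a => Z (fun m => (P m).[a]))) <-; last exact: posdef_bnd.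
  congr L; apply: funext => a; rewrite -[RHS](@invZ (g i ^+ n0)).
    by congr Z; apply: funext => m; rewrite /weight_act /v exprnP exprz_exp.
  by rewrite expf_neq0.
pose ex m n : int := n0%:Z * m - m0 * n%:Z.
pose Q m := \poly_(n < size (P m)) ((g i ^ ex m n - g j ^ ex m n) * (P m)`_n).
have cQ m n : (Q m)`_n = (g i ^ ex m n - g j ^ ex m n) * (P m)`_n.
  rewrite coef_poly; case: ltnP => // h.
  by rewrite nth_default ?mulr0.
have vQ a : v i a - v j a = (fun m => (Q m).[a]).
  apply: funext => m; rewrite horner_poly.
  have h k : v k a m = \sum_(n < size (P m)) g k ^ ex m n * (P m)`_n * a ^+ n.
    rewrite /v horner_coef mulr_sumr; apply: eq_bigr => n _.
    rewrite exprMn /ex expfzDr// -mulNr -(exprz_exp _ (- m0)) -exprnP.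
    by rewrite -!mulrA; congr (_ * _); rewrite mulrCA.
  have -> : (v i a - v j a) m = v i a m - v j a m by [].
  rewrite !h -sumrB; apply: eq_bigr => n _; ring.
under eq_fun do rewrite vQ.
apply: IH => [p pE||m n].
- by apply: hE; rewrite inE pE orbT.
- rewrite cQ mulf_neq0// subr_eq0 /ex.
  by rewrite mulr1 -/e; apply: gd.
- rewrite cQ mulf_eq0 negb_or => /andP[gg /hP[|]]; first by left.
  rewrite inE => /predU1P[[mm nn]|]; last by right.
  by move: gg; rewrite mm nn /ex mulrC subrr !expr0z subrr eqxx.
Qed.

Lemma coef_XaddC1_exp k n : (('X + 1 : {poly K}) ^+ k)`_n = 'C(k, n)%:R.
Proof.
rewrite exprD1n coef_sum; under eq_bigr => i _ do rewrite coefMn coefXn.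
have [nk|nk] := ltnP n k.+1.
  rewrite (bigD1 (Ordinal nk))//= eqxx big1 ?addr0// => i ink.
  case: eqP => [E|_]; last by rewrite mul0rn.
  by case/eqP: ink; apply: val_inj.
rewrite bin_small// big1// => i _; case: eqP => [E|_]; last by rewrite mul0rn.
by have := ltn_ord i; rewrite -E ltnNge nk.
Qed.

(** By invariance [Z w] is the average of [Z (weight_act (1 + a) w)].  A monomial
    [(m, n)] of this vector has [n <= m <= l], so [n * l = m] only for [(l, 1)]. *)
Lemma vanish_positive_weights (w : int -> K) :
  (forall m, w m != 0 -> 0 < m <= l%:Z) -> w l%:Z != 0 -> Z w = 0.
Proof.
move=> hw wl.
pose P m := w m *: ('X + 1 : {poly K}) ^+ `|m|%N.
pose E := [seq p <- [seq (k%:Z, n) | k <- iota 0 l.+1, n <- iota 0 l.+1] |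
  p.2%:Z * l%:Z != p.1].
have <- : L (fun a => Z (fun m => (P m).[a])) = Z w.
  rewrite -[RHS](mean_cst meanL).
  apply: (affine_mean_eq_off infK affL (s := [:: -1])).
  - exact: posdef_bnd.
  - exact: bnd_cst.
  move=> a; rewrite inE -addr_eq0 => a1; rewrite -[RHS](@invZ (a + 1))//.
  congr Z; apply: funext => m; rewrite /P !hornerE /weight_act.
  have [->|wm] := eqVneq (w m) 0; first by rewrite mul0r mulr0.
  have /andP[m0 _] := hw _ wm.
  by rewrite mulrC; congr (_ * _); rewrite -[in RHS](gtz0_abs m0).
apply: (@kill_monomials E).
- by move=> p; rewrite mem_filter => /andP[].
- by rewrite /P coefZ coef_XaddC1_exp mulf_neq0// bin1.
move=> m n; rewrite /P coefZ coef_XaddC1_exp mulf_eq0 negb_or => /andP[wm].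
have := hw _ wm; case: m {wm} => // m /andP[m0 ml] /=.
have [mn|nm _] := ltnP m n; first by rewrite bin_small// eqxx.
have nl : (n <= l)%N by lia.
have [E1|E1] := eqVneq (n%:Z * l%:Z) m%:Z; last first.
  right; rewrite mem_filter E1; apply/allpairsP; exists (m, n).
  by rewrite !mem_iota; split => //=; lia.
left; suff n1 : n = 1%N by move: E1; rewrite n1 mul1r => <-.
have : (n * l)%N = m by lia.
nia.
Qed.

End Vanishing.

(** * Vectors with weights of both signs *)

Lemma poly_roots_in_seq (K : fieldType) (p : {poly K}) :
  p != 0 -> exists s : seq K, forall x, x \notin s -> p.[x] != 0.
Proof.
move=> p0; have [/finite_seqP[s sE]|] := pselect (finite_set [set x | root p x]).
  exists s => x; apply: contra => px.
  by have : [set x | root p x] x by []; rewrite sE.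
move=> /(infinite_set_fset (size p))[B sB cB].
have rB : all (root p) B by apply/allP => x; apply: sB.
by have := max_poly_roots p0 rB (fset_uniq B); rewrite ltnNge cB.
Qed.

(** The leading coefficient of a polynomial is unchanged by a shift of the variable. *)
Lemma size_shift_difference (K : fieldType) (p : {poly K}) (c d : K) k :
  (size p <= k.+1)%N ->
  (size ((p \Po ('X + c%:P)) - (p \Po ('X + d%:P)))%R <= k)%N.
Proof.
move=> sp.
have sX (b : K) : size ('X + b%:P : {poly K}) = 2.
  by rewrite -[b]opprK polyCN size_XsubC.
have coefk b : (p \Po ('X + b%:P))`_k = p`_k.
  have [skp|ksp] := leqP (size p) k.
    by rewrite !nth_default// size_comp_poly2.
  have sk : size p = k.+1 by apply/eqP; rewrite eqn_leq sp.
  have lX : lead_coef ('X + b%:P) = 1.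
    by rewrite -[b]opprK polyCN lead_coefXsubC.
  have := lead_coef_comp p (q := 'X + b%:P); rewrite sX => /(_ isT).
  by rewrite lX expr1n mulr1 !lead_coefE size_comp_poly2// sk.
apply/leq_sizeP => j; rewrite leq_eqVlt => /predU1P[<-|kj].
  by rewrite coefB !coefk subrr.
by rewrite coefB !nth_default ?subrr// size_comp_poly2// (leq_trans sp).
Qed.

(** The summands have poles at distinct points, so the sum is not the zero rational
    function.  Over a common denominator, this says that the numerator [N] has a non-zero
    value at the pole [- p.2] of any of the summands. *)
Lemma inverse_powers_sum_neq0 (K : fieldType) (l : nat) (H : seq (K * K)) :
  (0 < l)%N -> H != [::] -> uniq [seq p.2 | p <- H] ->
  (forall p, p \in H -> p.1 != 0) ->
  exists s : seq K, forall a, a \notin s ->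
    \sum_(p <- H) p.1 * (a + p.2) ^- l != 0.
Proof.
move=> l0 Hn uH H1.
pose N := \sum_(p <- H) p.1 *: \prod_(q <- H | q.2 != p.2) ('X + q.2%:P) ^+ l.
have Na a : N.[a] = \sum_(p <- H) p.1 * \prod_(q <- H | q.2 != p.2) (a + q.2) ^+ l.
  rewrite horner_sum; apply: eq_bigr => p _; rewrite hornerZ horner_prod.
  by congr (_ * _); apply: eq_bigr => q _; rewrite !hornerE.
have N0 : N != 0.
  case: H Hn uH H1 @N Na => [//|p0 H _ uH H1 N Na].
  apply: contraTneq (isT) => N0.
  have : N.[- p0.2] = 0 by rewrite N0 horner0.
  rewrite Na big_cons big_seq [X in _ + X]big1 ?addr0 => [|p pH]; last first.
    rewrite big_cons ifT ?addNr ?expr0n ?gtn_eqF// ?mul0r ?mulr0//.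
    apply: contraTneq uH => E; rewrite /= negb_and negbK E; apply/orP; left.
    exact: map_f.
  move/eqP; rewrite mulf_eq0 (negbTE (H1 _ _)) ?inE ?eqxx//= prodf_seq_eq0.
  move=> /hasP[q _ /andP[qp]]; rewrite expf_eq0 => /andP[_].
  by rewrite addrC subr_eq0 (negbTE qp).
have D0 : N * \prod_(q <- H) ('X + q.2%:P) != 0.
  rewrite mulf_neq0// prodf_seq_neq0; apply/allP => q _ /=.
  by rewrite -[q.2]opprK polyCN polyXsubC_eq0.
have [s hs] := poly_roots_in_seq D0; exists s => a /hs.
rewrite hornerM mulf_eq0 negb_or horner_prod => /andP[Na0].
rewrite prodf_seq_neq0 => /allP aH.
have {}aH q : q \in H -> a + q.2 != 0 by move=> /aH /=; rewrite !hornerE.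
apply: contraNneq Na0 => S0; rewrite Na.
suff -> : \sum_(p <- H) p.1 * \prod_(q <- H | q.2 != p.2) (a + q.2) ^+ l =
    (\sum_(p <- H) p.1 * (a + p.2) ^- l) * \prod_(q <- H) (a + q.2) ^+ l.
  by rewrite S0 mul0r.
rewrite mulr_suml; apply: eq_big_seq => p pH; rewrite -mulrA; congr (_ * _).
rewrite [X in _ = _ * X](bigID (fun q : K * K => q.2 != p.2))/=.
rewrite mulrA mulrAC; set A := \prod_(_ <- _ | _) _; rewrite [_ * _ * A]mulrC.
suff -> : \prod_(q <- H | ~~ (q.2 != p.2)) (a + q.2) ^+ l = (a + p.2) ^+ l.
  by rewrite mulVf ?mulr1// expf_neq0// aH.
under eq_bigl => q do rewrite negbK.
rewrite -(big_map snd (pred1 p.2) (fun x => (a + x) ^+ l)).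
by rewrite -big_filter filter_pred1_uniq ?map_f// big_seq1.
Qed.

Section VanishingMixed.
Context (R : realType) (K : fieldType) (L : (K -> R) -> R).
Hypotheses (infK : infinite_set [set: K]) (affL : affine_mean L).
Context (Z : (int -> K) -> R).
Hypotheses (pZ : posdef Z) (invZ : weight_invariant Z).
Context (l : nat).
Hypotheses (l0 : l%:R != 0 :> K)
  (Zl : L (fun a => Z (single l%:Z a)) = 0).
Context (M : nat) (w : int -> K).
Hypotheses (hw : forall m, w m != 0 -> m != 0 /\ - M%:Z <= m <= l%:Z)
  (wl : w l%:Z != 0).

Let meanL : is_mean L. Proof. by case: affL. Qed.

(** Iterated differences of [a |-> weight_act a^-1 w]: an entry [(s, h)] of [H] stands
    for the shift by [h] with coefficient [s]. *)
Definition shifts (H : seq (K * K)) (a : K) : int -> K :=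
  fun m => (\sum_(p <- H) p.1 * (a + p.2) ^ (- m)) * w m.

(** The factor of [shifts H] in the coordinate [- n]. *)
Definition shift_poly (H : seq (K * K)) (n : nat) : {poly K} :=
  \sum_(p <- H) p.1 *: ('X + p.2%:P) ^+ n.

(** Each difference lowers the degree of every [shift_poly] by one.  When they are all zero,
    the coordinates of negative weight have disappeared while the coordinate [l] is
    non-zero for almost all [a], and [vanish_positive_weights] applies pointwise. *)
Lemma kill_negative_weights k (H : seq (K * K)) : H != [::] ->
  uniq [seq p.2 | p <- H] -> (forall p, p \in H -> p.1 != 0) ->
  (forall n, (n <= M)%N -> (size (shift_poly H n) <= k)%N) ->
  L (fun a => Z (shifts H a)) = 0.
Proof.
have lpos : (0 < l)%N by rewrite lt0n; apply: contraNneq l0 => ->.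
elim: k H => [|k IH] H Hn uH H1 hs.
  have [s hs0] := inverse_powers_sum_neq0 lpos Hn uH H1.
  apply: (affine_mean_finite infK affL (s := s)); first exact: posdef_bnd.
  move=> a /hs0 sa; apply: (vanish_positive_weights infK affL pZ invZ l0 Zl).
    move=> m; rewrite /shifts mulf_eq0 negb_or => /andP[sm /hw[m0 /andP[mM ->]]].
    rewrite andbT lt0r m0 leNgt; apply: contraNN sm => mlt0.
    have nM : (`|m| <= M)%N by lia.
    have := hs _ nM; rewrite leqn0 size_poly_eq0 => /eqP q0.
    have : (shift_poly H `|m|).[a] = 0 by rewrite q0 horner0.
    rewrite /shift_poly horner_sum => h; apply/eqP; rewrite -[RHS]h.
    apply: eq_bigr => p _; rewrite !hornerE; congr (_ * _).
    by rewrite exprnP; congr (_ ^ _); lia.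
  rewrite /shifts mulf_neq0//.
  by under eq_bigr => p _ do rewrite -exprnN.
(* The shifts [t] are chosen so that no two translates of the poles meet. *)
have [s|t [_ ht]] := @greedy_sequence K (fun=> True) (fun y x =>
     forall p q, p \in H -> q \in H -> p.2 + y != q.2 + x).
  have [|x] := @nonroot_exists K (\prod_(y <- s) \prod_(p <- H) \prod_(q <- H)
     ('X - (p.2 + y - q.2)%:P)) infK.
    rewrite prodf_seq_neq0; apply/allP => y _ /=.
    rewrite prodf_seq_neq0; apply/allP => p _ /=.
    rewrite prodf_seq_neq0; apply/allP => q _ /=.
    by rewrite polyXsubC_eq0.
  rewrite horner_prod prodf_seq_neq0 => /allP hx; exists x => // y ys p q pH qH.
  have := hx y ys; rewrite /= horner_prod prodf_seq_neq0 => /allP /(_ _ pH) /=.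
  rewrite horner_prod prodf_seq_neq0 => /allP /(_ _ qH) /=.
  rewrite hornerXsubC subr_eq0; apply: contra => /eqP ->.
  by rewrite addrAC subrr add0r.
apply: (van_der_corput pZ (v := fun i a => shifts H (a + t i)) meanL) => [i|i j ij].
  have [_ /(_ (t i)) h _] := affL.
  by rewrite (h (fun a => Z (shifts H a)))//; apply: posdef_bnd.
pose H' := [seq (p.1, p.2 + t i) | p <- H] ++ [seq (- p.1, p.2 + t j) | p <- H].
have E a : shifts H (a + t i) - shifts H (a + t j) = shifts H' a.
  apply: funext => m; rewrite /H' [RHS]/shifts big_cat/= !big_map/=.
  have -> : (shifts H (a + t i) - shifts H (a + t j)) m =
    shifts H (a + t i) m - shifts H (a + t j) m by [].
  rewrite /shifts -mulrBl; congr (_ * _); congr (_ + _).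
    by apply: eq_bigr => p _; rewrite addrA addrAC.
  rewrite -sumrN; apply: eq_bigr => p _.
  by rewrite mulNr addrA addrAC.
under eq_fun do rewrite E.
apply: IH.
- by case: H Hn @H' {uH H1 hs ht E}.
- rewrite /H' map_cat cat_uniq -!map_comp.
  have inj c : injective (fun x : K => x + c) by apply: addIr.
  rewrite (map_comp (fun x => x + t i) snd) (map_comp (fun x => x + t j) snd).
  have uH' : uniq (map snd H) by [].
  rewrite (map_inj_uniq (inj (t i))) (map_inj_uniq (inj (t j))) uH'/= andbT -all_predC.
  apply/allP => x /mapP[y /mapP[q qH ->] ->] /=.
  apply/negP => /mapP[z /mapP[p pH ->]] /eqP.
  by rewrite eq_sym (negbTE (ht _ _ ij _ _ pH qH)).
- move=> p; rewrite mem_cat => /orP[] /mapP[q qH ->] /=; last rewrite oppr_eq0;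
  exact: H1.
- move=> n nM.
  have -> : shift_poly H' n = (shift_poly H n \Po ('X + (t i)%:P)) -
     (shift_poly H n \Po ('X + (t j)%:P)).
    rewrite /shift_poly /H' big_cat/= !big_map/= !raddf_sum/=.
    congr (_ + _); apply: eq_bigr => p _;
    rewrite comp_polyZ rmorphXn/= comp_polyD comp_polyX comp_polyC polyCD.
      by rewrite addrAC addrA.
    by rewrite scaleNr addrAC addrA.
  exact/size_shift_difference/hs.
Qed.

Lemma vanish_mixed_weights : Z w = 0.
Proof.
pose H : seq (K * K) := [:: (1, 0)].
have <- : L (fun a => Z (shifts H a)) = Z w.
  rewrite -[RHS](mean_cst meanL).
  apply: (affine_mean_eq_off infK affL (s := [:: 0])).
  - exact: posdef_bnd.
  - exact: bnd_cst.
  move=> a; rewrite inE => a0; rewrite -[RHS](@invZ a^-1) ?invr_eq0//.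
  congr Z; apply: funext => m.
  by rewrite /shifts /H big_seq1/= mul1r addr0 /weight_act exprz_inv.
apply: (@kill_negative_weights M.+1) => //.
  by move=> p; rewrite inE => /eqP->; rewrite oner_neq0.
move=> n nM; rewrite /shift_poly big_seq1/= scale1r addr0 size_polyXn ltnS//.
Qed.

End VanishingMixed.

(** * Averaging out one coordinate *)

(** In terms of a spectral measure of [Z], this is the part carried by the characters that
    are trivial on the coordinate [l]. *)
Definition coordinate_mean (R : realType) (K : fieldType) (L : (K -> R) -> R)
    (l : int) (Z : (int -> K) -> R) (c : int -> K) : R :=
  L (fun a => Z (c + single l a)).

Lemma addfE (K : fieldType) (f g : int -> K) m : (f + g) m = f m + g m.
Proof. by []. Qed.

Lemma singleD (K : fieldType) l (a b : K) :
  single l (a + b) = single l a + single l b.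
Proof.
apply: funext => m; rewrite addfE /single.
by case: eqP => // _; rewrite addr0.
Qed.

Lemma singleN (K : fieldType) l (a : K) : single l (- a) = - single l a.
Proof.
apply: (addIr (single l a)); rewrite addNr -singleD addNr.
by apply: funext => m; rewrite /single if_same.
Qed.

Section CoordinateMean.
Context (R : realType) (K : fieldType) (L : (K -> R) -> R).
Hypotheses (infK : infinite_set [set: K]) (affL : affine_mean L).
Context (Z : (int -> K) -> R).
Hypotheses (pZ : posdef Z) (invZ : weight_invariant Z).
Context (l : int).

Let meanL : is_mean L. Proof. by case: affL. Qed.
Let Zl := coordinate_mean L l Z.

Lemma coordinate_mean_scale t c : t != 0 ->
  L (fun a => Z (c + single l (t * a))) = Zl c.
Proof.
move=> t0; have [_ _ /(_ t t0) h] := affL.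
by rewrite (h (fun a => Z (c + single l a)))//; apply: posdef_bnd.
Qed.

Lemma coordinate_mean_opp c : L (fun a => Z (c - single l a)) = Zl c.
Proof.
rewrite -(@coordinate_mean_scale (-1)) ?oppr_eq0 ?oner_neq0//.
by congr L; apply: funext => a; rewrite mulN1r singleN.
Qed.

Lemma coordinate_mean_shift c x : Zl (c + single l x) = Zl c.
Proof.
have [_ /(_ x) h _] := affL.
rewrite [RHS]/Zl/coordinate_mean -h; last exact: posdef_bnd.
by congr L; apply: funext => a; rewrite singleD addrA addrAC.
Qed.

Lemma coordinate_mean_even u : Zl (- u) = Zl u.
Proof.
rewrite -coordinate_mean_opp -[RHS]/(L _); congr L; apply: funext => a.
by rewrite -opprD pZ.1.
Qed.

(** Translating each point by [t i * a] along the axis, for [N] distinct values [t i], and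
    averaging over [a] gives [N * A Z + N * (N - 1) * A Zl >= 0] for the
    quadratic form [A]: the differences [t i - t j] with [i != j] are non-zero, hence
    absorbed by dilation invariance.  Then let [N] tend to infinity. *)
Lemma coordinate_mean_posdef : posdef Zl.
Proof.
split; first exact: coordinate_mean_even.
move=> s; have [t [_ tD]] := distinct_powers infK (oner_neq0 int).
pose A := @quadratic_form R (int -> K) s.
have bA (f : K -> (int -> K) -> R) :
  (forall c, bnd (fun a => f a c)) -> bnd (fun a => A (f a)).
  exact: quadratic_form_bnd.
have LA (f : K -> (int -> K) -> R) : (forall c, bnd (fun a => f a c)) ->
  L (fun a => A (f a)) = A (fun c => L (fun a => f a c)).
  exact: mean_quadratic_form.
have key N : 0 <= N%:R * A Z + (N * N.-1)%:R * A Zl.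
  pose f i j a c := Z (c + single l ((t i - t j) * a)).
  have bf i j c : bnd (fun a => f i j a c) by apply: posdef_bnd.
  pose F a := \sum_(i <- iota 0 N) \sum_(j <- iota 0 N) A (f i j a).
  have bF1 i : bnd (fun a => \sum_(j <- iota 0 N) A (f i j a)).
    by apply: (@bnd_sum R K _ _ (fun j a => A (f i j a))) => j; apply: bA.
  have bF : bnd F.
    exact: (@bnd_sum R K _ _ (fun i a => \sum_(j <- iota 0 N) A (f i j a))).
  have LF : L F = N%:R * A Z + (N * N.-1)%:R * A Zl.
    rewrite /F (@mean_sum _ _ _ meanL _ _ (fun i a => \sum_(j <- iota 0 N) A (f i j a)))//.
    rewrite (eq_big_seq (fun=> A Z + N.-1%:R * A Zl)) => [|i iN].
      rewrite big_const_seq count_predT iter_addr_0 size_iota -(mulr_natl (_ + _)).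
      by rewrite mulrDr mulrA natrM.
    rewrite (@mean_sum _ _ _ meanL _ _ (fun j a => A (f i j a))); last by move=> j;
      apply: bA.
    rewrite (big_rem i)//= LA//; congr (_ + _).
      congr A; apply: funext => c; rewrite -[RHS](mean_cst meanL); congr L.
      apply: funext => a; rewrite /f subrr mul0r.
      by congr Z; apply: funext => m; rewrite addfE /single if_same addr0.
    rewrite (eq_big_seq (fun=> A Zl)) => [|j].
      by rewrite big_const_seq count_predT iter_addr_0 size_rem// size_iota mulr_natl.
    rewrite mem_rem_uniq ?iota_uniq// inE => /andP[ji _]; rewrite LA//.
    congr A; apply: funext => c; apply: coordinate_mean_scale.
    rewrite subr_eq0; have [ij|ij|ij] := ltngtP i j; last by rewrite ij eqxx in ji.
      by have := tD _ _ ij; rewrite !expr1z.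
    by have := tD _ _ ij; rewrite !expr1z eq_sym.
  rewrite -LF; apply: mean_ge0 => // a.
  have := pZ.2 (flatten [seq [seq (x.1, x.2 + single l (t i * a)) | x <- s] | i <- iota 0 N]).
  rewrite /quadratic_form big_flatten/= big_map.
  rewrite (eq_bigr (fun i => \sum_(j <- iota 0 N) A (f i j a)))// => i _.
  rewrite big_map exchange_big/= big_flatten/= big_map.
  apply: eq_bigr => j _; rewrite big_map exchange_big/=.
  apply: eq_bigr => x _; apply: eq_bigr => y _; congr (_ * Z _).
  by rewrite opprD addrACA -singleN -singleD mulrBl.
apply/ler_addgt0Pr => e e0; rewrite -/(A Zl).
have [N hN] : exists N, `|A Z| / e < N%:R.
  by exists (Num.bound (`|A Z| / e)); rewrite archi_boundP// divr_ge0// ltW.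
rewrite ltr_pdivrMr// in hN.
have := key N.+1; rewrite /= natrM -mulrA -mulrDr pmulr_rge0 ?ltr0n// => h.
have N0 : 0 < N%:R :> R.
  rewrite ltr0n lt0n; apply: contraTneq hN => ->.
  by rewrite mul0r -leNgt.
rewrite -(pmulr_rge0 _ N0) mulrDr; have := ler_norm (A Z); lra.
Qed.

(** Apply positive definiteness of [Z] to the points of [s], together with their
    translates along the axis taken with the opposite weights, and average. *)
Lemma coordinate_mean_complement_posdef : posdef (fun c => Z c - Zl c).
Proof.
split => [u|s]; first by rewrite pZ.1 coordinate_mean_even.
pose G (x y : R * (int -> K)) a := x.1 * y.1 *
  (2 * Z (x.2 - y.2) - Z (x.2 - y.2 + single l a) - Z (x.2 - y.2 - single l a)).
have bZ (v : K -> int -> K) : bnd (fun a => Z (v a)) by apply: posdef_bnd.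
have bc c : bnd (fun _ : K => c : R) by apply: bnd_cst.
have bG x y : bnd (G x y) by apply: bndM => //; do !apply: bndB.
have LG x y : L (G x y) = 2 * (x.1 * y.1 * (Z (x.2 - y.2) - Zl (x.2 - y.2))).
  rewrite (meanZ meanL); last by do !apply: bndB.
  rewrite (meanB meanL)//; last exact: bndB.
  rewrite (meanB meanL)// (mean_cst meanL) coordinate_mean_opp -/(coordinate_mean _ _ _ _).
  by rewrite -/Zl; ring.
rewrite /quadratic_form.
have : 0 <= L (fun a => \sum_(x <- s) \sum_(y <- s) G x y a).
  have b1 x : bnd (fun a => \sum_(y <- s) G x y a) by apply: bnd_sum.
  apply: mean_ge0 => //; first exact: (@bnd_sum R K _ _ (fun x a => \sum_(y <- s) G x y a)).
  move=> a; have := pZ.2 (s ++ [seq (- x.1, x.2 + single l a) | x <- s]).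
  rewrite /quadratic_form big_cat/= big_map.
  under eq_bigr => x _ do rewrite big_cat/= big_map/=.
  under [X in _ + X]eq_bigr => x _ do rewrite big_cat/= big_map/=.
  rewrite -big_split/= => h; apply: le_trans h _; rewrite le_eqVlt; apply/orP; left.
  apply/eqP; apply: eq_bigr => x _; rewrite -!big_split/=.
  apply: eq_bigr => y _; rewrite /G.
  have -> : x.2 - (y.2 + single l a) = x.2 - y.2 - single l a by rewrite opprD addrA.
  have -> : x.2 + single l a - y.2 = x.2 - y.2 + single l a by rewrite addrAC.
  have -> : x.2 + single l a - (y.2 + single l a) = x.2 - y.2.
    by rewrite opprD addrACA subrr addr0.
  ring.
have b1 x : bnd (fun a => \sum_(y <- s) G x y a) by apply: bnd_sum.
rewrite (@mean_sum _ _ _ meanL _ _ (fun x a => \sum_(y <- s) G x y a))//.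
under eq_bigr => x _ do rewrite (mean_sum meanL)//.
under eq_bigr => x _ do under eq_bigr => y _ do rewrite LG.
under eq_bigr => x _ do rewrite -mulr_sumr.
by rewrite -mulr_sumr pmulr_rge0.
Qed.

Lemma coordinate_mean_weight_invariant : weight_invariant Zl.
Proof.
move=> b c b0; rewrite -(@coordinate_mean_scale (b ^ l)) ?expfz_neq0//.
rewrite -[RHS]/(L _); congr L; apply: funext => a; rewrite -[RHS](invZ _ b0).
congr Z; apply: funext => m.
rewrite /weight_act !addfE mulrDr; congr (_ + _).
by rewrite /single; case: eqP => [->//|_]; rewrite mulr0.
Qed.

Lemma coordinate_mean_complement_axis :
  L (fun a => Z (single l a) - Zl (single l a)) = 0.
Proof.
have e a : single l a = 0 + single l a by rewrite add0r.
rewrite (meanB meanL); [|exact: posdef_bnd|]; last first.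
  apply: posdef_bnd; exact: coordinate_mean_posdef.
under [X in _ - L X]eq_fun do rewrite e coordinate_mean_shift.
rewrite (mean_cst meanL).
by under eq_fun do rewrite e; rewrite -/(coordinate_mean _ _ _ _) subrr.
Qed.

End CoordinateMean.

(** * Nonnegativity of invariant positive definite functions *)

Definition nonneg_on_supports (R : realType) (K : fieldType) (n : nat) : Prop :=
  forall (Z : (int -> K) -> R) (w : int -> K) (D : seq int),
    posdef Z -> weight_invariant Z -> (size D <= n)%N ->
    (forall m, w m != 0 -> m \in D /\ m%:~R != 0 :> K) -> 0 <= Z w.

Section Positivity.
Context (R : realType) (K : fieldType) (L : (K -> R) -> R).
Hypotheses (infK : infinite_set [set: K]) (affL : affine_mean L).

(** In [Z w = Zl w + (Z - Zl) w] the coordinate [l] of [w] may be erased from the first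
    term, which is then covered by the induction hypothesis; the second term is zero. *)
Lemma posdef_ge0_step n : nonneg_on_supports R K n ->
  forall (Z : (int -> K) -> R) (w : int -> K) (D : seq int) (l : int),
  posdef Z -> weight_invariant Z -> (size D <= n.+1)%N ->
  (forall m, w m != 0 -> m \in D /\ m%:~R != 0 :> K) ->
  0 < l -> w l != 0 -> (forall m, w m != 0 -> m <= l) -> 0 <= Z w.
Proof.
move=> IH Z w D [l|//] pZ invZ sD wD _ wl lmax.
pose Zl := coordinate_mean L l%:Z Z.
have -> : Z w = Zl w + (Z w - Zl w) by rewrite addrCA subrr addr0.
have pZl : posdef Zl by apply: coordinate_mean_posdef.
have iZl : weight_invariant Zl by apply: coordinate_mean_weight_invariant.
have -> : Z w - Zl w = 0.
  apply: (@vanish_mixed_weights _ _ L infK affL (fun c => Z c - Zl c) _ _ l _ _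
    (\max_(m <- D) `|m|%N)) => //.
  - exact: (coordinate_mean_complement_posdef affL pZ).
  - by move=> b c b0; rewrite invZ// iZl.
  - by have [_] := wD _ wl.
  - exact: (coordinate_mean_complement_axis infK affL pZ).
  move=> m wm; have [mD m0] := wD _ wm; split.
    by apply: contraNneq m0 => ->.
  rewrite lmax// andbT.
  have := @leq_bigmax_seq _ D xpredT (fun m : int => `|m|%N) m mD isT.
  by move=> mM; rewrite lerNl; apply: le_trans (ler_norm _) _;
    rewrite normrN -abszE lez_nat.
rewrite addr0 /Zl -(coordinate_mean_shift affL pZ l%:Z w (- w l)).
apply: (IH _ _ [seq m <- D | m != l%:Z]) => //.
  rewrite size_filter -ltnS; apply: leq_trans sD.
  rewrite -(count_predC (fun m : int => m != l%:Z)) -addn1 leq_add2l -has_count.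
  by apply/hasP; exists l%:Z => /=; [case: (wD _ wl)|rewrite negbK].
move=> m; rewrite addfE /single mem_filter; case: (m =P l%:Z) => [->|_];
  first by rewrite subrr eqxx.
by rewrite addr0 => /wD.
Qed.

Lemma int_seq_max (s : seq int) : s != [::] ->
  exists2 l, l \in s & forall m, m \in s -> m <= l.
Proof.
elim: s => // x [|y s] IH _.
  by exists x; rewrite ?inE// => m; rewrite inE => /eqP->.
have [//|l ls lm] := IH; have [xl|lx] := leP x l.
  exists l; first by rewrite inE ls orbT.
  by move=> m; rewrite inE => /predU1P[->//|/lm].
exists x; first by rewrite inE eqxx.
move=> m; rewrite inE => /predU1P[->//|/lm ml].
exact: le_trans ml (ltW lx).
Qed.

(** If no weight of [w] is positive, then reversing the sign of all the weights makes them
    all positive; this corresponds to replacing [b] by [b^-1] in the action. *)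
Lemma invariant_posdef_ge0 n : nonneg_on_supports R K n.
Proof.
elim: n => [|n IH] Z w D pZ invZ sD wD.
  suff -> : w = 0 by apply: posdef_ge0.
  apply: funext => m; apply/eqP/negPn/negP => /wD[].
  by move: sD; rewrite leqn0 size_eq0 => /eqP->.
have [E|Dn] := eqVneq [seq m <- D | w m != 0] [::].
  suff -> : w = 0 by apply: posdef_ge0.
  apply: funext => m; apply/eqP/negPn/negP => wm; have [mD _] := wD _ wm.
  have : m \in [seq m <- D | w m != 0] by rewrite mem_filter wm.
  by rewrite E.
have [l] := int_seq_max Dn; rewrite mem_filter => /andP[wl lD] lmax.
have {}lmax m : w m != 0 -> m <= l.
  by move=> wm; apply: lmax; rewrite mem_filter wm; case: (wD _ wm).
have [lpos|lneg] := ltP 0 l; first exact: (posdef_ge0_step IH pZ invZ sD wD lpos wl).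
pose flip (c : int -> K) m := c (- m).
pose Z' c := Z (flip c).
have [l'] : exists2 l', l' \in [seq - m | m <- D & w m != 0] &
    forall m, m \in [seq - m | m <- D & w m != 0] -> m <= l'.
  by apply: int_seq_max; case: [seq _ <- _ | _] Dn.
move=> /mapP[k]; rewrite mem_filter => /andP[wk kD] -> kmax.
have -> : Z w = Z' (flip w).
  by rewrite /Z' /flip; congr Z; apply: funext => m; rewrite opprK.
apply: (@posdef_ge0_step _ IH Z' (flip w) [seq - m | m <- D] (- k)).
- split=> [u|s]; first exact: pZ.1.
  have := pZ.2 [seq (x.1, flip x.2) | x <- s].
  rewrite /quadratic_form big_map; under eq_bigr => x _ do rewrite big_map.
  exact.
- move=> b c b0; rewrite /Z' -[RHS](invZ b^-1) ?invr_eq0//.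
  congr Z; apply: funext => m; rewrite /flip /weight_act.
  by rewrite exprz_inv.
- by rewrite size_map.
- move=> m /wD[mD m0]; split; first by apply/mapP; exists (- m); rewrite ?opprK.
  by rewrite -oppr_eq0 -rmorphN.
- have [_ k0] := wD _ wk; rewrite oppr_gt0 lt_neqAle (le_trans (lmax _ wk))// andbT.
  by apply: contraNneq k0 => ->.
- by rewrite /flip opprK.
- move=> m wm; apply: kmax; apply/mapP; exists (- m); rewrite ?opprK//.
  by rewrite mem_filter wm; case: (wD _ wm).
Qed.

End Positivity.

(** * From upper Banach density to an invariant mean *)

Lemma card_fsetI_count (T : choiceType) (A B : {fset T}) :
  #|` (A `&` B)%fset| = count [in B] A.
Proof.
rewrite -size_filter; apply: perm_size.
by apply: uniq_perm; rewrite ?filter_uniq ?fset_uniq// => x;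
  rewrite mem_filter in_fsetI andbC.
Qed.

Lemma big_fset_difference (R : realType) (T : choiceType) (A B : {fset T})
    (G : T -> R) (C : R) : 0 <= C -> (forall x, `|G x| <= C) ->
  `|\sum_(x <- A) G x - \sum_(x <- B) G x| <=
    C * ((#|` A| - #|` (A `&` B)%fset|)%:R + (#|` B| - #|` (A `&` B)%fset|)%:R).
Proof.
move=> C0 hC.
have out (A1 B1 : {fset T}) : `|\sum_(x <- A1 | x \notin B1) G x| <=
    C * (#|` A1| - #|` (A1 `&` B1)%fset|)%:R.
  apply: le_trans (ler_norm_sum _ _ _) _.
  apply: (@le_trans _ _ (\sum_(x <- A1 | x \notin B1) C)); first exact: ler_sum.
  rewrite big_const_seq iter_addr_0 -[leLHS]mulr_natr ler_wpM2l//.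
  by rewrite card_fsetI_count -(count_predC [in B1] A1) addKn ler_nat.
rewrite (bigID [in B])/= [X in _ - X](bigID [in A])/=.
have -> : \sum_(x <- B | x \in A) G x = \sum_(x <- A | x \in B) G x.
  rewrite -[LHS]big_filter -[RHS]big_filter; apply: perm_big.
  apply: uniq_perm; rewrite ?filter_uniq ?fset_uniq// => x.
  by rewrite !mem_filter andbC.
rewrite opprD addrACA subrr add0r.
apply: le_trans (ler_normB _ _) _; rewrite mulrDr lerD//.
by rewrite fsetIC; apply: out.
Qed.

Lemma limn_esup_frequently (R : realType) (u : nat -> R) :
  (0 < limn_esup (fun n => (u n)%:E))%E ->
  exists2 d : R, 0 < d & forall N, exists2 n, (N <= n)%N & d < u n.
Proof.
move=> h.
have [d d0 dh] : exists2 d : R, 0 < d & (d%:E < limn_esup (fun n => (u n)%:E))%E.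
  move: h; case: (limn_esup _) => [r r0|_|//].
    rewrite lte_fin in r0; exists (r / 2); first by rewrite divr_gt0.
    by rewrite lte_fin; lra.
  by exists 1; rewrite ?ltry.
exists d => // N.
have : (d%:E < ereal_sup ((fun n => (u n)%:E) @` [set n | (N <= n)%N]))%E.
  apply: lt_le_trans dh _; apply: ereal_inf_lbound.
  by exists [set n | (N <= n)%N] => //; exists N.
by move=> /ereal_sup_gt[_ [n Nn <-]]; rewrite lte_fin => dn; exists n.
Qed.

Definition translation_invariant (R : realType) (V : zmodType)
    (L : (V -> R) -> R) : Prop :=
  forall b, invariant_under L (fun x => x + b).

Definition indicator (R : realType) (V : zmodType) (E : set V) : V -> R :=
  fun x => (x \in E)%:R.

Lemma indicator_bnd (R : realType) (V : zmodType) (E : set V) :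
  bnd (indicator R E).
Proof. by exists 1 => x; rewrite /indicator; case: (_ \in _);
  rewrite ?normr1 ?normr0. Qed.

(** The mean is the ultrafilter limit of the averages over [F (k N)], where [k] selects
    Foelner sets in which [E] has density greater than a fixed [d > 0]. *)
Lemma Folner_mean (R : realType) (V : zmodType) (E : set V) :
  (0 < upper_Banach_density R E)%E ->
  exists L : (V -> R) -> R,
    [/\ is_mean L, translation_invariant L & 0 < L (indicator R E)].
Proof.
move=> /ereal_sup_gt[_ [F [Fne Finv] <-]].
move=> /limn_esup_frequently[d d0 hd].
have /choice[k hk] : forall N, exists n, (N <= n)%N /\
    d < #|` [fset x in F n | x \in E]%fset|%:R / #|` F n|%:R.
  by move=> N; have [n Nn dn] := hd N; exists n.
pose A N G : R := #|` F (k N)|%:R^-1 * \sum_(x <- F (k N)) G x.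
have F0 n : 0 < #|` F n|%:R :> R by rewrite ltr0n cardfs_gt0.
have Ale N G C : (forall x, `|G x| <= C) -> `|A N G| <= C.
  move=> hC; rewrite /A normrM ger0_norm ?invr_ge0//.
  rewrite mulrC ler_pdivrMr//; apply: le_trans (ler_norm_sum _ _ _) _.
  apply: (@le_trans _ _ (\sum_(x <- F (k N)) C)); first exact: ler_sum.
  by rewrite big_const_seq iter_addr_0 count_predT -[leLHS]mulr_natr.
have bA G : bnd G -> bnd (fun N => A N G).
  by move=> [C hC]; exists C => N; apply: Ale.
have mL := ulim_mean R.
exists (fun G => ulim (fun N => A N G)); split.
- split=> [G G' bG bG'|c G bG|G bG G0|].
  + rewrite -(meanD mL); [|exact: bA..]; congr ulim; apply: funext => N.
    by rewrite /A big_split/= mulrDr.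
  + rewrite -(meanZ mL); [|exact: bA]; congr ulim; apply: funext => N.
    by rewrite /A -mulr_sumr mulrCA.
  + apply: (mean_ge0 mL); first exact: bA.
    by move=> N; rewrite mulr_ge0 ?invr_ge0// sumr_ge0.
  + rewrite -[RHS](mean_cst mL); congr ulim; apply: funext => N.
    rewrite /A big_const_seq iter_addr_0 count_predT mulVf// gt_eqF//.
- move=> b G bG; have [C hC] := bG.
  have C0 : 0 <= C by apply: le_trans (hC 0).
  apply/eqP; rewrite -subr_eq0 -(meanB mL); [|exact/bA/bnd_comp|exact: bA].
  apply/eqP; apply: ulim_cvg_oo; apply/cvgr0Pnorm_le => e e0.
  have := Finv b; move=> /cvgrPdist_le /(_ (e / (2 * C + 1))).
  have C1 : 0 < 2 * C + 1 by rewrite ltr_wpDl// mulr_ge0.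
  move=> /(_ (divr_gt0 e0 C1))[N0 _ hN0].
  exists N0 => // N /= N0N.
  have := hN0 (k N) (leq_trans N0N (hk N).1) => /=.
  set Fn := F (k N); set r := _ / _ => hr.
  have Fn0 : 0 < #|` Fn|%:R :> R by apply: F0.
  have sE : \sum_(x <- Fn) G (x + b) = \sum_(x <- [fset (x + b)%R | x in Fn]%fset) G x.
    by rewrite big_imfset//= => x y _ _; apply: addIr.
  have cI : #|` [fset (x + b)%R | x in Fn]%fset| = #|` Fn|.
    by rewrite card_imfset//; apply: addIr.
  rewrite /A -/Fn -mulrBr sE normrM ger0_norm ?invr_ge0// mulrC ler_pdivrMr//.
  apply: le_trans (big_fset_difference _ _ C0 hC) _.
  rewrite cI fsetIC -mulr2n.
  have le1 : (#|` (Fn `&` [fset (x + b)%R | x in Fn])%fset| <= #|` Fn|)%N.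
    by apply: fsubset_leq_card; apply: fsubsetIl.
  rewrite natrB// -(ler_pdivrMr _ _ Fn0).
  have -> : C * ((#|` Fn|%:R - #|` (Fn `&` [fset (x + b)%R | x in Fn])%fset|%:R) *+ 2) /
      #|` Fn|%:R = 2 * C * (1 - r) :> R.
    by rewrite /r mulr2n; field; rewrite gt_eqF// F0.
  have {}hr : 1 - r <= e / (2 * C + 1) by apply: le_trans (ler_norm _) hr.
  apply: (@le_trans _ _ (2 * C * (e / (2 * C + 1)))).
    by rewrite ler_wpM2l// mulr_ge0.
  rewrite mulrA ler_pdivrMr//; nra.
- apply: (lt_le_trans d0) => /=; rewrite -(mean_cst mL d). apply: (mean_le mL).
  + exact: bnd_cst.
  + exact/bA/indicator_bnd.
  move=> N; apply: ltW; apply: lt_le_trans (hk N).2 _.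
  rewrite /A mulrC ler_wpM2l ?invr_ge0//.
  rewrite /indicator -natr_sum ler_nat.
  rewrite (_ : #|` _| = count [in E] (F (k N))).
    by rewrite -sum1_count big_mkcond/= leq_sum// => x _; case: ifP.
  rewrite -size_filter; apply: perm_size.
  by apply: uniq_perm; rewrite ?filter_uniq ?fset_uniq// => x;
    rewrite mem_filter !inE/= andbC.
Qed.

(** * Recurrence along orbits *)

Lemma posdef_comp (R : realType) (V W : zmodType) (Z : W -> R) (phi : V -> W) :
  (forall x y, phi (x - y) = phi x - phi y) -> posdef Z -> posdef (Z \o phi).
Proof.
move=> phiB [ev psd].
have phiN u : phi (- u) = - phi u.
  by rewrite -[in LHS]sub0r phiB -[X in phi X](subrr 0) phiB subrr sub0r.
split=> [u|s]; first by rewrite /= phiN ev.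
have := psd [seq (x.1, phi x.2) | x <- s].
rewrite /quadratic_form big_map; under eq_bigr => x _ do rewrite big_map.
by under eq_bigr => x _ do under eq_bigr => y _ do rewrite /= -phiB.
Qed.

Section Correlation.
Context (R : realType) (V : zmodType) (L : (V -> R) -> R).
Hypotheses (meanL : is_mean L) (invL : translation_invariant L).

Definition correlation (f : V -> R) (u : V) : R := L (fun x => f x * f (x + u)).

(** For [g x = \sum_p p.1 * f (x - p.2)], the quadratic form at the points [p] is the
    variance [L (g ^ 2) - (L g) ^ 2]. *)
Lemma correlation_posdef f : bnd f ->
  posdef (fun u => correlation f u - L f ^+ 2).
Proof.
move=> bf.
have bff u v : bnd (fun x => f (x + u) * f (x + v)).
  by apply: bndM; apply: bnd_comp.
have corr u v : L (fun x => f (x - u) * f (x - v)) = correlation f (u - v).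
  rewrite /correlation -[RHS](invL (- u)); last first.
    by apply: bndM => //; apply: bnd_comp.
  by congr L; apply: funext => x; rewrite addrA subrK.
split=> [u|s].
  congr (_ - _); rewrite -[in LHS](sub0r u) -corr -[in RHS](subr0 u) -corr.
  by congr L; apply: funext => x; rewrite mulrC.
pose g x := \sum_(p <- s) p.1 * f (x - p.2).
have bfp (p : R * V) : bnd (fun x => p.1 * f (x - p.2)).
  by apply: bndM; [exact: bnd_cst|exact: bnd_comp].
have bg : bnd g by apply: bnd_sum.
have Lg : L g = (\sum_(p <- s) p.1) * L f.
  rewrite /g (@mean_sum _ _ _ meanL _ _ (fun (p : R * V) x => p.1 * f (x - p.2)))//.
  rewrite mulr_suml; apply: eq_bigr => p _.
  by rewrite (meanZ meanL) ?(invL (- p.2))//; apply: bnd_comp.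
have Lgg : L (fun x => g x * g x) =
    \sum_(p <- s) \sum_(q <- s) p.1 * q.1 * correlation f (p.2 - q.2).
  pose h (p q : R * V) x := p.1 * q.1 * (f (x - p.2) * f (x - q.2)).
  have bh p q : bnd (h p q) by apply: bndM => //; apply: bnd_cst.
  have -> : (fun x => g x * g x) = fun x => \sum_(p <- s) \sum_(q <- s) h p q x.
    apply: funext => x; rewrite /g mulr_suml; apply: eq_bigr => p _.
    by rewrite mulr_sumr; apply: eq_bigr => q _; rewrite mulrACA.
  have bh1 p : bnd (fun x => \sum_(q <- s) h p q x) by apply: bnd_sum.
  rewrite (@mean_sum _ _ _ meanL _ _ (fun p x => \sum_(q <- s) h p q x))//.
  apply: eq_bigr => p _; rewrite (mean_sum meanL)//.
  by apply: eq_bigr => q _; rewrite (meanZ meanL)// corr.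
have var : 0 <= L (fun x => g x * g x) - L g * L g.
  have bgg : bnd (fun x => g x * g x) by apply: bndM.
  have b2 : bnd (fun x => 2 * L g * g x) by apply: bndM => //; apply: bnd_cst.
  have b3 : bnd (fun x => g x * g x - 2 * L g * g x) by apply: bndB.
  have : 0 <= L (fun x => g x * g x - 2 * L g * g x + L g * L g).
    apply: mean_ge0 => //; first by apply: bndD => //; apply: bnd_cst.
    move=> x; have := sqr_ge0 (g x - L g).
    by rewrite (_ : (g x - L g) ^+ 2 = g x * g x - 2 * L g * g x + L g * L g)//; ring.
  rewrite (meanD meanL)//; last exact: bnd_cst.
  rewrite (meanB meanL)// (meanZ meanL)// (mean_cst meanL); lra.
apply: le_trans var _; rewrite /quadratic_form Lgg Lg le_eqVlt; apply/orP; left;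
  apply/eqP.
rewrite mulrACA -expr2 -[L f * L f]expr2 expr2 mulr_suml mulr_suml -sumrB.
apply: eq_bigr => p _; rewrite mulr_sumr mulr_suml -sumrB.
by apply: eq_bigr => q _; rewrite mulrBr.
Qed.

End Correlation.

(** Split off from [m] the largest power [q] of the characteristic that divides it:
    the [q]-th power map is then an iterate of the Frobenius map.  In characteristic
    zero, [q = 1]. *)
Lemma additive_power_part (K : fieldType) (m : int) : m != 0 ->
  exists q m' : int, [/\ m = m' * q, m'%:~R != 0 :> K &
    forall x y : K, (x + y) ^ q = x ^ q + y ^ q].
Proof.
move=> m0; have n0 : (0 < absz m)%N by rewrite absz_gt0.
pose pi : nat_pred := [pchar K].
exists ((absz m)`_pi)%N%:Z, (sgz m * ((absz m)`_pi^')%N%:Z); split.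
- by rewrite -mulrA -PoszM mulnC partnC// -intEsg.
- rewrite intrM mulf_neq0//.
    by case: sgzP m0 => // _ _; rewrite ?rmorphN1 ?oppr_eq0 oner_neq0.
  apply/negP => h; have [p pK] := natf0_pchar (part_gt0 _ _) h.
  have : p \in (pi^')%N.
    apply: (pnatPpi (part_pnat (pi^')%N (absz m))).
    by rewrite mem_primes (pcharf_prime pK) part_gt0 (dvdn_pcharf pK).
  by rewrite inE /= pK.
- by move=> x y; rewrite -!exprnP exprDn_pchar//; exact: part_pnat.
Qed.

Section Recurrence.
Context (R : realType) (K : fieldType) (U : lmodType K).
Context (rho : K -> {linear U -> U}) (r : nat) (W : 'I_r -> {pred U}) (m : 'I_r -> int).
Hypotheses (K_countable : countable [set: K]) (K_infinite : infinite_set [set: K]).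
Hypotheses (decU : weight_decomposition rho W m) (m_neq0 : forall i, m i != 0).
Context (L : (U -> R) -> R).
Hypotheses (meanL : is_mean L) (invL : translation_invariant L).

(** With [f = \sum_i v i] and [m i = m' i * q i], the map
    [phi c = \sum_i (c (m' i)) ^ q i *: v i] is additive, intertwines the two
    actions, and sends the indicator function of the set of all [m' i] to [f]. *)
Lemma orbit_lift (f : U) : exists (D : seq int) (phi : (int -> K) -> U) (w : int -> K),
  [/\ forall x y, phi (x - y) = phi x - phi y,
      forall a, a != 0 -> phi (weight_act a w) = rho a f
    & forall l, w l != 0 -> l \in D /\ l%:~R != 0 :> K].
Proof.
have [_ dec _ actW] := decU.
have [v [[vW ->] _]] := dec f.
have /choice[q] : forall i, exists q, exists m' : int, [/\ m i = m' * q,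
    m'%:~R != 0 :> K & forall x y : K, (x + y) ^ q = x ^ q + y ^ q].
  by move=> i; apply: additive_power_part.
move=> /choice[m' hm'].
pose D := [seq m' i | i <- enum 'I_r].
have mD i : m' i \in D by apply: map_f; rewrite mem_enum.
have qB i (x y : K) : (x - y) ^ q i = x ^ q i - y ^ q i.
  have [_ _ qD] := hm' i.
  by apply/eqP; rewrite eq_sym subr_eq -qD subrK.
exists D, (fun c => \sum_(i < r) (c (m' i)) ^ q i *: v i), (fun l => (l \in D)%:R).
split=> [x y|a a0|l].
- by rewrite -sumrB; apply: eq_bigr => i _; rewrite -scalerBl -qB.
- rewrite linear_sum; apply: eq_bigr => i _; rewrite (actW a a0 i _ (vW i)).
  rewrite /weight_act mD.
  by rewrite mulr1 exprz_exp; have [<-] := hm' i.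
- have [/mapP[i _ ->] _|_] := boolP (l \in D); last by rewrite eqxx.
  by split=> //; case: (hm' i).
Qed.

(** [Z] is the average over the action of [K^*] of the centred correlation function of
    [S], pulled back along [phi].  If [S - S] missed the orbit of [f], [Z] would be
    [- d ^ 2 < 0] at [w]. *)
Lemma orbit_recurrence (S : set U) (f : U) : 0 < L (indicator R S) ->
  exists a s, [/\ a != 0, S s & S (s + rho a f)].
Proof.
move=> S0; apply: contrapT => nS.
have [D [phi [w [phiB phiw wD]]]] := orbit_lift f.
have [A affA] := affine_mean_exists R K_countable.
have mA : is_mean A by case: affA.
pose d := L (indicator R S).
pose Z0 u := correlation L (indicator R S) u - d ^+ 2.
have pZ0 : posdef Z0 by apply: correlation_posdef => //; apply: indicator_bnd.
pose Z (c : int -> K) := A (fun a => Z0 (phi (weight_act a c))).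
have bZ c : bnd (fun a => Z0 (phi (weight_act a c))) by apply: posdef_bnd.
have pZ : posdef Z.
  apply: posdef_mean => // a.
  apply: (posdef_comp (phi := fun c => phi (weight_act a c))) pZ0 => x y.
  by rewrite -phiB; congr phi; apply: funext => n; apply: mulrBr.
have iZ : weight_invariant Z.
  move=> b c b0; have [_ _ /(_ _ b0) h] := affA.
  rewrite /Z -[RHS]h//; congr A; apply: funext => a; congr (Z0 (phi _)).
  by apply: funext => n; rewrite /weight_act mulrA [b * a]mulrC expfzMl.
have := invariant_posdef_ge0 K_infinite affA pZ iZ (leqnn (size D)) wD.
suff -> : Z w = - d ^+ 2 by rewrite oppr_ge0 leNgt exprn_gt0.
rewrite -[RHS](mean_cst mA) /Z.
apply: (affine_mean_eq_off K_infinite affA (s := [:: 0])) => //.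
  exact: bnd_cst.
move=> a; rewrite inE => a0; rewrite phiw// /Z0 /correlation.
rewrite -[RHS]add0r; congr (_ - _); rewrite -[RHS](mean_cst meanL).
congr L; apply: funext => x; rewrite /indicator -natrM mulnb.
case: andP => // -[]; rewrite !inE => xS xaS; case: nS.
by exists a, x.
Qed.

(** The set [S f] of the points of [E] that are bad for [f] has mean zero, since a set of
    positive mean contains a pair [u], [u + rho a f]; finitely many such sets cannot
    cover [E]. *)
Lemma simultaneous_recurrence (E : set U) (s : seq U) : 0 < L (indicator R E) ->
  exists2 u, E u & forall f, f \in s -> exists2 a, a != 0 & E (u + rho a f).
Proof.
move=> E0; apply: contrapT => nE.
pose S f := [set u | E u /\ forall a, a != 0 -> ~ E (u + rho a f)].
have S0 f : L (indicator R (S f)) = 0.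
  apply/eqP; rewrite eq_le; apply/andP; split; last first.
    by apply: mean_ge0 => //; apply: indicator_bnd.
  rewrite leNgt; apply/negP => /(orbit_recurrence f)[a [u [a0 [_ hu] [Eu _]]]].
  exact: (hu a a0).
have bS : bnd (fun u => \sum_(f <- s) indicator R (S f) u).
  by apply: bnd_sum => f; apply: indicator_bnd.
have : L (indicator R E) <= L (fun u => \sum_(f <- s) indicator R (S f) u).
  apply: mean_le => //; first exact: indicator_bnd.
  move=> u; rewrite [leLHS]/indicator; have [|_] := boolP (u \in E); last first.
    by apply: sumr_ge0 => f _; rewrite /indicator.
  rewrite inE => Eu.
  have [f fs Sf] : exists2 f, f \in s & S f u.
    apply: contrapT => nf; apply: nE; exists u => // f fs.
    apply: contrapT => na; apply: nf; exists f => //; split => // a a0 Ea.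
    by apply: na; exists a.
  rewrite (big_rem f)//= {1}/indicator mem_set// lerDl.
  by apply: sumr_ge0 => g _; rewrite /indicator.
rewrite (@mean_sum _ _ _ meanL _ _ (fun f => indicator R (S f))); last first.
  by move=> f; apply: indicator_bnd.
by rewrite big1 ?leNgt ?E0// => f _; apply: S0.
Qed.

End Recurrence.

Theorem theorem1p24 (R : realType) (K : fieldType) (U : lmodType K)
    (K_countable : countable [set: K]) (K_infinite : infinite_set [set: K])
    (U_countable : countable [set: U])
    (rho : K -> {linear U -> U})
    (rho_rep : representation rho)
    (rho_diag : diagonalizable_nonzero_weights rho)
    (Y : Type) (psi : U -> Y) (psi_inv : rep_invariant rho psi)
    (E : set U) (E_pos : (0 < upper_Banach_density R E)%E) :
  (forall F : set U, finite_set F ->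
     exists2 u : U, E u & psi @` F `<=` psi @` translate_sub E u) /\
  psi @` difference_set E = range psi.
Proof.
have [r [W [m [dec m0]]]] := rho_diag.
have [L [meanL invL LE]] := Folner_mean E_pos.
have main (F : set U) : finite_set F ->
    exists2 u : U, E u & psi @` F `<=` psi @` translate_sub E u.
  move=> /finite_seqP[s ->].
  have [u Eu hu] :=
    simultaneous_recurrence K_countable K_infinite dec m0 meanL invL s LE.
  exists u => // _ [f /= /hu[a a0 Ea] <-].
  exists (rho a f); last exact: psi_inv.
  by exists (u + rho a f) => //; rewrite addrC addKr.
split=> //; apply/seteqP; split=> [_ [x _ <-]|_ [x _ <-]]; first by exists x.
have [u Eu] := main [set x] (finite_set1 x).
move=> /(_ (psi x)) [|_ [e Ee <-] <-]; first by exists x.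
by exists (e - u) => //; exists e => //; exists u.
Qed.
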